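(* Let $\Phi$ be a crystallographic root system of rank $n$ with positive system $\Phi^+$, let $k$ be a positive integer, and consider the $k$-Catalan arrangement of $\Phi$. Let $M=\{H_{\alpha_1}^{i_1},H_{\alpha_2}^{i_2},\ldots,H_{\alpha_m}^{i_m}\}$ be any set of $m$ hyperplanes with $i_j\in\{1,\ldots,k\}$ and $\alpha_j\in\Phi^+$ for all $j\in\{1,\ldots,m\}$. Let $U(M)$ be the set of dominant regions $R$ of the $k$-Catalan arrangement such that every hyperplane in $M$ is a floor of $R$, and let $L(M)$ be the set of dominant regions $R'$ of the $k$-Catalan arrangement such that every hyperplane in $M$ is a ceiling of $R'$. Then there is a bijection from $U(M)$ to $L(M)$.
   Context: $\Phi$ lives in a real Euclidean space $V$ with inner product $\langle\cdot,\cdot\rangle$. For $\alpha\in\Phi$ and $r\in\mathbb{R}$ let $H_\alpha^r=\{x\in V\mid\langle x,\alpha\rangle=r\}$. The $k$-Catalan arrangement of $\Phi$ is the set of hyperplanes $H_\alpha^r$ with $\alpha\in\Phi$ and $r\in\{0,1,\ldots,k\}$; its regions are the connected components of the complement of the union of these hyperplanes. A region $R$ is dominant if $\langle x,\alpha\rangle>0$ for all $\alpha\in\Phi^+$ and $x\in R$. The walls of a region $R$ are the hyperplanes of the arrangement that support a facet of $R$. A ceiling of $R$ is a wall of $R$ that does not contain the origin and such that the origin lies on the same side of it as $R$. A floor of $R$ is a wall of $R$ that does not contain the origin and separates $R$ from the origin. *)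

(* Defs.v *)
From HB Require Import structures.
From mathcomp Require Import all_boot all_order all_algebra.
From mathcomp Require Import all_classical all_reals all_analysis.
Set Implicit Arguments. Unset Strict Implicit. Unset Printing Implicit Defensive.
Import Order.TTheory GRing.Theory Num.Theory.
Import numFieldNormedType.Exports.
Local Open Scope classical_set_scope.
Local Open Scope ring_scope.

Definition dotp (R : realType) (n : nat) (u v : 'rV[R]_n) : R := (u *m v^T) 0 0.

Definition refl (R : realType) (n : nat) (a b : 'rV[R]_n) : 'rV[R]_n :=
  b - ((2 * dotp b a) / dotp a a) *: a.

Definition is_cryst_root_system (R : realType) (n : nat) (Phi : seq 'rV[R]_n) : Prop :=
  [/\ 0 \notin Phi,
      (1%:M <= \matrix_(i < size Phi) nth 0 Phi i)%MS,
      (forall a c, a \in Phi -> c *: a \in Phi -> c = 1 \/ c = -1),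
      (forall a b, a \in Phi -> b \in Phi -> refl a b \in Phi) &
      (forall a b, a \in Phi -> b \in Phi ->
          exists z : int, (2 * dotp b a) / dotp a a = z%:~R)].

Definition is_positive_system (R : realType) (n : nat) (Phi : seq 'rV[R]_n)
  (PhiP : set 'rV[R]_n) : Prop :=
  exists x0 : 'rV[R]_n, (forall a, a \in Phi -> dotp x0 a != 0) /\
    (forall a, PhiP a <-> (a \in Phi /\ 0 < dotp x0 a)).

Definition hyp (R : realType) (n : nat) (a : 'rV[R]_n) (r : R) : set 'rV[R]_n :=
  [set x | dotp x a = r].

Definition cat_hyp (R : realType) (n : nat) (Phi : seq 'rV[R]_n) (k : nat)
  (H : set 'rV[R]_n) : Prop :=
  exists a r, [/\ a \in Phi, (r <= k)%N & H = hyp a r%:R].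

Definition cat_complement (R : realType) (n : nat) (Phi : seq 'rV[R]_n) (k : nat)
  : set 'rV[R]_n :=
  [set x | forall H, cat_hyp Phi k H -> ~ H x].

Definition is_region (R : realType) (n : nat) (Phi : seq 'rV[R]_n) (k : nat)
  (Rg : set 'rV[R]_n) : Prop :=
  exists2 x, cat_complement Phi k x & Rg = connected_component (cat_complement Phi k) x.

Definition dominant (R : realType) (n : nat) (PhiP : set 'rV[R]_n)
  (Rg : set 'rV[R]_n) : Prop :=
  forall a x, PhiP a -> Rg x -> 0 < dotp x a.

(* H is a wall of Rg: H is a hyperplane of the arrangement supporting a facet
   of Rg, i.e. closure Rg contains a relatively open nonempty subset of H
   (closure Rg /\ H has dimension n-1). *)
Definition is_wall (R : realType) (n : nat) (Phi : seq 'rV[R]_n) (k : nat)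
  (Rg H : set 'rV[R]_n) : Prop :=
  cat_hyp Phi k H /\
  exists x, H x /\ \forall y \near x, H y -> closure Rg y.

Definition is_ceiling (R : realType) (n : nat) (Phi : seq 'rV[R]_n) (k : nat)
  (Rg : set 'rV[R]_n) (a : 'rV[R]_n) (r : R) : Prop :=
  [/\ is_wall Phi k Rg (hyp a r), ~ hyp a r 0 &
      forall x, Rg x -> 0 < (dotp x a - r) * (dotp 0 a - r)].

Definition is_floor (R : realType) (n : nat) (Phi : seq 'rV[R]_n) (k : nat)
  (Rg : set 'rV[R]_n) (a : 'rV[R]_n) (r : R) : Prop :=
  [/\ is_wall Phi k Rg (hyp a r), ~ hyp a r 0 &
      forall x, Rg x -> (dotp x a - r) * (dotp 0 a - r) < 0].

(* Main.v *)
Require Import Defs.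
From HB Require Import structures.
From mathcomp Require Import all_boot all_order all_algebra.
From mathcomp Require Import all_classical all_reals all_analysis.
From mathcomp Require Import zify ring lra.
Set Implicit Arguments. Unset Strict Implicit. Unset Printing Implicit Defensive.
Import Order.TTheory GRing.Theory Num.Theory.
Import numFieldNormedType.Exports.
Local Open Scope classical_set_scope.
Local Open Scope ring_scope.

(* Let X be the intersection of the hyperplanes of M and let R be a dominant
   region whose floors include M.  The bijection sends R to the region opposite
   to R at a relative interior point p of F = X /\ closure R: central symmetry at
   p preserves the local arrangement, so the hyperplanes of M are walls of the
   opposite region, now as ceilings, and F is locally unchanged, so the construction
   is an involution exchanging floors and ceilings.

   What has to be shown is that F is nonempty and lies in no hyperplane through
   the origin.  By Farkas' lemma, a failure yields an integral relation
   sum f_j = sum g_i + c with walls f_j in M, affine roots g_i of the arrangement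
   nonnegative on R, and c >= 0.  If all f_j are floors, move to the left the g_i
   with negative gradient: both sides become the same nonzero vector, so
   some left and some right gradient have positive inner product and their
   difference is a root.  Its level is again in [-k, k], hence it has a constant
   sign on R, which is forced since f_j is a wall; this shortens the relation.
   Ceilings are treated in the same way with the two signs exchanged. *)

(** * Roots *)

Section DotProduct.
Context {R : realType} {n : nat}.
Implicit Types u v w x : 'rV[R]_n.

Lemma dotpE u v : dotp u v = \sum_j u 0 j * v 0 j.
Proof. by rewrite /dotp mxE; apply: eq_bigr => j _; rewrite mxE. Qed.

Lemma dotpC u v : dotp u v = dotp v u.
Proof. by rewrite !dotpE; apply: eq_bigr => j _; rewrite mulrC. Qed.

Lemma dotpDl u v w : dotp (u + v) w = dotp u w + dotp v w.
Proof. by rewrite /dotp mulmxDl mxE. Qed.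

Lemma dotpZl c u w : dotp (c *: u) w = c * dotp u w.
Proof. by rewrite /dotp -scalemxAl mxE. Qed.

Lemma dotp0l w : dotp 0 w = 0.
Proof. by rewrite /dotp mul0mx mxE. Qed.

Lemma dotpNl u w : dotp (- u) w = - dotp u w.
Proof. by rewrite -scaleN1r dotpZl mulN1r. Qed.

Lemma dotpBl u v w : dotp (u - v) w = dotp u w - dotp v w.
Proof. by rewrite dotpDl dotpNl. Qed.

Lemma dotpDr u v w : dotp w (u + v) = dotp w u + dotp w v.
Proof. by rewrite dotpC dotpDl !(dotpC w). Qed.

Lemma dotpZr c u w : dotp w (c *: u) = c * dotp w u.
Proof. by rewrite dotpC dotpZl dotpC. Qed.

Lemma dotp0r w : dotp w 0 = 0.
Proof. by rewrite dotpC dotp0l. Qed.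

Lemma dotpNr u w : dotp w (- u) = - dotp w u.
Proof. by rewrite dotpC dotpNl dotpC. Qed.

Lemma dotpBr u v w : dotp w (u - v) = dotp w u - dotp w v.
Proof. by rewrite dotpDr dotpNr. Qed.

Lemma dotp_sumr (I : Type) (s : seq I) (P : pred I) (F : I -> 'rV[R]_n) w :
  dotp w (\sum_(i <- s | P i) F i) = \sum_(i <- s | P i) dotp w (F i).
Proof. by apply: (big_morph (dotp w)) => [u v|]; rewrite ?dotpDr ?dotp0r. Qed.

Lemma dotp_suml (I : Type) (s : seq I) (F : I -> 'rV[R]_n) w :
  dotp (\sum_(i <- s) F i) w = \sum_(i <- s) dotp (F i) w.
Proof. by rewrite dotpC dotp_sumr; apply: eq_bigr => i _; rewrite dotpC. Qed.

Lemma dotpp_ge0 u : 0 <= dotp u u.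
Proof. by rewrite dotpE sumr_ge0 // => j _; rewrite -expr2 sqr_ge0. Qed.

Lemma dotpp_eq0 u : (dotp u u == 0) = (u == 0).
Proof.
apply/eqP/eqP => [|->]; last by rewrite dotp0l.
rewrite dotpE => /eqP; rewrite psumr_eq0; last first.
  by move=> j _; rewrite -expr2 sqr_ge0.
move=> /allP u0; apply/rowP => j; rewrite mxE.
by have := u0 j (mem_index_enum j); rewrite mulf_eq0 orbb => /eqP.
Qed.

Lemma dotpp_gt0 u : (0 < dotp u u) = (u != 0).
Proof. by rewrite lt0r dotpp_ge0 andbT dotpp_eq0. Qed.

Lemma continuous_dotp v : continuous (fun x => dotp x v).
Proof.
move=> x; rewrite /dotp.
have -> : (fun x : 'rV[R]_n => (x *m v^T) 0 0) = (fun x => \sum_j x 0 j * v 0 j).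
  by apply/funext => y; rewrite -dotpE.
apply: (cvg_big _ (nbhs_filter x) (Fa := fun j => x 0 j * v 0 j)) => [|j _].
  exact: add_continuous.
by apply: cvgMr_tmp; exact: coord_continuous.
Qed.

End DotProduct.

Section Roots.
Context {R : realType} {n : nat} {Phi : seq 'rV[R]_n}.
Hypothesis root_system : is_cryst_root_system Phi.
Implicit Types a b : 'rV[R]_n.

Lemma root_neq0 a : a \in Phi -> a != 0.
Proof. by case: root_system => Phi0 _ _ _ _; apply: contraTneq => ->. Qed.

Lemma opp_root a : a \in Phi -> - a \in Phi.
Proof.
move=> aPhi; have [_ _ _ Prefl _] := root_system.
have := Prefl _ _ aPhi aPhi; rewrite /refl mulfK ?dotpp_eq0 ?root_neq0 //.
by have -> : a - 2 *: a = - a by rewrite scaler_nat mulr2n opprD addrA subrr add0r.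
Qed.

(** Both Cartan integers are positive. If one is 1, a reflection gives [a - b] up to sign. If both
    are at least 2, [<a, b>] bounds both squared lengths, so [a - b] would vanish. *)
Lemma root_sub a b : a \in Phi -> b \in Phi -> 0 < dotp a b -> a != b ->
  a - b \in Phi.
Proof.
move=> aPhi bPhi ab0 a_neq_b.
have [_ _ Pprop Prefl Pint] := root_system.
have aa0 : 0 < dotp a a by rewrite dotpp_gt0 root_neq0.
have bb0 : 0 < dotp b b by rewrite dotpp_gt0 root_neq0.
have [z1 z1E] := Pint _ _ bPhi aPhi.
have [z2 z2E] := Pint _ _ aPhi bPhi.
have z1_gt0 : 0 < z1 by rewrite -(ltr0z R) -z1E divr_gt0 // mulr_gt0.
have z2_gt0 : 0 < z2 by rewrite -(ltr0z R) -z2E divr_gt0 // mulr_gt0 // dotpC.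
have [z11|z1N1] := eqVneq z1 1.
  by have := Prefl _ _ bPhi aPhi; rewrite /refl z1E z11 scale1r.
have [z21|z2N1] := eqVneq z2 1.
  have := Prefl _ _ aPhi bPhi; rewrite /refl z2E z21 scale1r => /opp_root.
  by rewrite opprB.
have z1_ge2 : 2 <= z1 by lia.
have z2_ge2 : 2 <= z2 by lia.
have h1 : dotp b b <= dotp a b.
  move: z1_ge2; rewrite -(ler_int R) -z1E ler_pdivlMr // => h; lra.
have h2 : dotp a a <= dotp a b.
  move: z2_ge2; rewrite -(ler_int R) -z2E ler_pdivlMr // dotpC => h; lra.
have : dotp (a - b) (a - b) <= 0.
  by rewrite !(dotpBl, dotpBr) (dotpC b a); lra.
by rewrite leNgt dotpp_gt0 subr_eq0 a_neq_b.
Qed.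

End Roots.

(** * Farkas' lemma *)

Section Farkas.

(** Induction on the generators, with [v] and [b] general so that the hypothesis also applies to
    projected vectors. The field is arbitrary because rational certificates are wanted. *)
Lemma farkas (F : realFieldType) (m : nat) (I : eqType) (A : seq I)
    (v : I -> 'rV[F]_m) (b : 'rV[F]_m) :
  (exists y : 'cV[F]_m,
     (forall i, i \in A -> 0 <= (v i *m y) 0 0) /\ (b *m y) 0 0 < 0) \/
  (exists cs : seq (F * I),
     (forall p, p \in cs -> 0 <= p.1 /\ p.2 \in A) /\
     b = \sum_(p <- cs) p.1 *: v p.2).
Proof.
elim: A v b => [|j A IH] v b.
  have [->|b0] := eqVneq b 0; first by right; exists [::]; rewrite big_nil.
  left; exists (- b^T); split=> //.
  rewrite mulmxN mxE oppr_lt0 mxE.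
  have [i bi] : exists i, b 0 i != 0.
    apply/existsP; apply: contraNT b0; rewrite negb_exists => /forallP b0.
    by apply/eqP/rowP => i; rewrite mxE; apply/eqP; rewrite -[_ == _]negbK b0.
  rewrite (bigD1 i) //= mxE ltr_pwDl //; first by rewrite -expr2 exprn_even_gt0.
  by apply: sumr_ge0 => l _; rewrite mxE -expr2 sqr_ge0.
have [[y [yA yb]]|[cs [csA ->]]] := IH v b; last first.
  right; exists cs; split=> // p /csA[? ?].
  by split=> //; rewrite in_cons; apply/orP; right.
have [vj0|vj0] := leP 0 ((v j *m y) 0 0).
  by left; exists y; split=> // i; rewrite inE => /predU1P[->|/yA].
(* Bartl's elimination: project along [y] onto the kernel of [v j]. *)
pose d := (v j *m y) 0 0.
pose prj (w : 'rV[F]_m) := w - ((w *m y) 0 0 / d) *: v j.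
have prjE w z : (prj w *m z) 0 0 = (w *m (z - ((v j *m z) 0 0 / d) *: y)) 0 0.
  rewrite /prj mulmxBl mulmxBr -scalemxAl -scalemxAr.
  have mxB (u t : 'M[F]_1) e : (u - e *: t) 0 0 = u 0 0 - e * t 0 0.
    by rewrite !mxE.
  rewrite !mxB mulrAC [in RHS]mulrAC; congr (_ - _ / _).
  exact: mulrC.
have [[z [zA zb]]|[cs [csA bE]]] := IH (fun i => prj (v i)) (prj b).
  left; exists (z - ((v j *m z) 0 0 / d) *: y); split; last by rewrite -prjE.
  move=> i; rewrite inE => /predU1P[->|iA]; last by rewrite -prjE; apply: zA.
  by rewrite -prjE /prj divff ?lt_eqF // scale1r subrr mul0mx mxE.
(* Undoing the projections leaves this coefficient on [v j]. It is nonnegative because [d] and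
   [b *m y] are negative while [y] is nonnegative on [A]. *)
right; pose c := (b *m y) 0 0 / d - \sum_(p <- cs) p.1 * ((v p.2 *m y) 0 0 / d).
exists ((c, j) :: cs); split.
  move=> p; rewrite inE => /predU1P[->|/csA[? ?]] ; last first.
    by split=> //; apply/orP; right.
  split; last by rewrite eqxx.
  rewrite /c subr_ge0; apply: (@le_trans _ _ 0).
    rewrite big_seq; apply: sumr_le0 => p' /csA[p0 /yA pA].
    by rewrite mulr_ge0_le0 // mulr_ge0_le0 // invr_le0 ltW.
  by rewrite ltW // nmulr_rgt0 // invr_lt0.
rewrite -[LHS](subrK (((b *m y) 0 0 / d) *: v j)) -/(prj b) bE big_cons /=.
rewrite [LHS]addrC /c scalerBl -addrA; congr (_ + _).
rewrite scaler_suml addrC -sumrB; apply: eq_bigr => p _.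
by rewrite scalerBr scalerA.
Qed.

Lemma rat_nat_numden (c : rat) : 0 <= c ->
  exists p q : nat, (0 < q)%N /\ q%:R * c = p%:R.
Proof.
move=> c0; exists `|numq c|%N, `|denq c|%N; split; first by rewrite absz_gt0 denq_neq0.
have natE (z : int) : 0 <= z -> `|z|%:R = z%:~R :> rat.
  by case: z => // z _; rewrite absz_nat pmulrn.
rewrite !natE ?numq_ge0 ?denq_ge0 //.
by rewrite -{2}[c]divq_num_den mulrC divfK // intr_eq0 denq_neq0.
Qed.

(** Clearing denominators turns the coefficients into multiplicities, so the certificate is a list
    that can be rewritten combinatorially. *)
Lemma farkas_rat (m : nat) (I : eqType) (A : seq I)
    (v : I -> 'rV[rat]_m) (b : 'rV[rat]_m) :
  (exists y : 'cV[rat]_m,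
     (forall i, i \in A -> 0 <= (v i *m y) 0 0) /\ (b *m y) 0 0 < 0) \/
  (exists (N : nat) (s : seq I),
     [/\ (0 < N)%N, {subset s <= A} & N%:R *: b = \sum_(i <- s) v i]).
Proof.
have [?|[cs [csA ->]]] := farkas A v b; [by left|right].
elim: cs csA => [_|[c i] cs IH csA].
  by exists 1%N, [::]; split=> //; rewrite !big_nil scaler0.
have [p pcs|N [s [N0 sA sE]]] := IH; first by apply: csA; rewrite inE pcs orbT.
have [/rat_nat_numden[p [q [q0 qcE]]] /= iA] := csA (c, i) (mem_head _ _).
exists (q * N)%N, (nseq (p * N) i ++ flatten (nseq q s)); split.
- by rewrite muln_gt0 q0.
- move=> l; rewrite mem_cat => /orP[/nseqP[->]//|/flattenP[t /nseqP[-> _]]].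
  exact: sA.
- rewrite big_cons big_cat big_flatten /= scalerDr !big_nseq !iter_addr !addr0.
  rewrite natrM -[in X in _ + X]scalerA sE scaler_nat scalerA; congr (_ + _).
  by rewrite mulrAC qcE -natrM scaler_nat.
Qed.

End Farkas.

(** * Linear programming for affine functions with root gradients *)

Section LinearProgramming.
Context {R : realType} {n : nat} {Phi : seq 'rV[R]_n}.
Hypothesis root_system : is_cryst_root_system Phi.

(* A pair [(v, m)] stands for the affine function [x |-> <x, v> - m]. *)
Notation affine := ('rV[R]_n * int)%type.

Definition cartan (v a : 'rV[R]_n) : int :=
  xget 0 [set z : int | (2 * dotp v a) / dotp a a = z%:~R].

Lemma cartanE v a : v \in 0 :: Phi -> a \in Phi ->
  (cartan v a)%:~R = (2 * dotp v a) / dotp a a.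
Proof.
move=> vPhi aPhi; rewrite /cartan; case: xgetP => [z _ -> //|/= noz].
have [_ _ _ _ Pint] := root_system.
move: vPhi; rewrite inE => /predU1P[v0|vPhi].
  by case: (noz 0) => /=; rewrite v0 dotp0l mulr0 mul0r.
by have [z /noz] := Pint _ _ aPhi vPhi.
Qed.

Definition enc (g : affine) : 'rV[rat]_(size Phi + 1) :=
  row_mx (\row_j (cartan g.1 Phi`_j)%:~R) (const_mx g.2%:~R).

(** A combination of coroots: the transpose of [enc], which turns a rational functional on encodings
    into a vector of the ambient space. *)
Definition dec (y : 'cV[rat]_(size Phi + 1)) : 'rV[R]_n :=
  \sum_(j < size Phi)
    (ratr (y (lshift 1 j) 0) * (2 / dotp Phi`_j Phi`_j)) *: Phi`_j.

Lemma enc_dec g y : g.1 \in 0 :: Phi ->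
  ratr ((enc g *m y) 0 0) = dotp (dec y) g.1 + ratr (y (rshift _ 0) 0) * g.2%:~R.
Proof.
move=> gPhi; rewrite mxE big_split_ord /= big_ord1 rmorphD rmorph_sum /=.
congr (_ + _); last by rewrite /enc row_mxEr mxE rmorphM /= ratr_int mulrC.
rewrite /dec dotp_suml; apply: eq_bigr => j _.
rewrite /enc row_mxEl mxE rmorphM /= ratr_int cartanE ?mem_nth //.
by rewrite dotpZl (dotpC g.1); ring.
Qed.

(** The sum is orthogonal to each of its terms, hence to itself. This lets equal Cartan coordinates
    imply equal vectors. *)
Lemma sum_roots_ortho (s : seq affine) :
  (forall g, g \in s -> g.1 \in 0 :: Phi) ->
  (forall a, a \in Phi -> dotp (\sum_(g <- s) g.1) a = 0) ->
  \sum_(g <- s) g.1 = 0.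
Proof.
move=> sPhi s_ortho; apply/eqP; rewrite -dotpp_eq0 dotp_sumr; apply/eqP.
apply: big1_seq => g /= /sPhi; rewrite inE => /predU1P[->|/s_ortho//].
by rewrite dotp0r.
Qed.

(* Farkas' lemma over the rationals, the root coordinates being taken
   against the coroots; rationality makes the certificate a multiset. *)
Lemma affine_farkas (As : seq affine) (g0 : affine) :
  (forall g, g \in g0 :: As -> g.1 \in 0 :: Phi) ->
  - g0.1 \in 0 :: Phi ->
  (exists (p : 'rV[R]_n) (t : R),
     (forall g, g \in As -> 0 <= dotp p g.1 - t * g.2%:~R) /\
     dotp p g0.1 - t * g0.2%:~R < 0) \/
  (exists (N : nat) (s : seq affine),
     [/\ (0 < N)%N, {subset s <= As},
         g0.1 *+ N = \sum_(g <- s) g.1 & g0.2 *+ N = \sum_(g <- s) g.2]).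
Proof.
move=> AsPhi g0N.
have [[y [yA yg0]]|[N [s [N0 sA sE]]]] := farkas_rat As enc (enc g0).
  left; exists (dec y), (- ratr (y (rshift _ 0) 0)); split.
    move=> g gA; rewrite mulNr opprK -enc_dec ?ler0q ?yA //.
    by rewrite AsPhi // inE gA orbT.
  by rewrite mulNr opprK -enc_dec ?ltrq0 // AsPhi ?mem_head.
right; exists N, s; split=> //; last first.
  have := congr1 (fun u : 'rV[rat]_(size Phi + 1) => u 0 (rshift _ 0)) sE.
  rewrite /= summxE mxE /enc row_mxEr mxE.
  rewrite (eq_bigr (fun g => g.2%:~R)) => [|g _]; last by rewrite row_mxEr mxE.
  rewrite mulr_natl -rmorph_sum /= => E; apply: (@intr_inj rat).
  by rewrite rmorphMn.
apply/eqP; rewrite eq_sym -subr_eq0 -mulNrn; apply/eqP.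
(* Appending [N] copies of [- g0.1] makes the difference of the two sides a sum of gradients in
   [0 :: Phi]. *)
pose s' := s ++ nseq N (- g0.1, 0) : seq affine.
have -> : \sum_(g <- s) g.1 + (- g0.1) *+ N = \sum_(g <- s') g.1.
  by rewrite big_cat big_nseq iter_addr addr0.
apply: sum_roots_ortho.
  move=> g; rewrite mem_cat => /orP[/sA gA|/nseqP[-> _] //].
  by rewrite AsPhi // inE gA orbT.
move=> a aPhi; have [j ja <-] := nthP 0 aPhi.
have aa0 : dotp Phi`_j Phi`_j != 0.
  by rewrite dotpp_eq0 (root_neq0 root_system) ?mem_nth.
have := congr1 (fun u : 'rV[rat]_(size Phi + 1) => u 0 (lshift _ (Ordinal ja))) sE.
rewrite /= summxE mxE /enc row_mxEl mxE /=.
rewrite (eq_bigr (fun g => (cartan g.1 Phi`_j)%:~R)) => [|g _]; last first.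
  by rewrite row_mxEl mxE.
rewrite -[N%:R]/(N%:Z%:~R) -rmorphM -rmorph_sum /= => /intr_inj E.
have {}E : N%:R * ((2 * dotp g0.1 Phi`_j) / dotp Phi`_j Phi`_j) =
    \sum_(g <- s) (2 * dotp g.1 Phi`_j) / dotp Phi`_j Phi`_j :> R.
  rewrite -cartanE ?AsPhi ?mem_head ?mem_nth // -[N%:R]/(N%:Z%:~R) -rmorphM /= E.
  rewrite rmorph_sum; apply: eq_big_seq => g gs /=; rewrite cartanE ?mem_nth //.
  by rewrite AsPhi // inE sA ?orbT.
move: E; rewrite -mulr_suml mulrA => /(divIf aa0); rewrite -mulr_sumr mulrCA.
have two0 : 2 != 0 :> R by rewrite pnatr_eq0.
move=> /(mulfI two0) E.
by rewrite big_cat big_nseq iter_addr addr0 /= dotpDl -scaler_nat dotpZl dotpNl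
  dotp_suml -E mulrN subrr.
Qed.

End LinearProgramming.

(** * Relations between walls *)

Section SeqSums.

Lemma sumr_seq_gt0 (R : numDomainType) (I : eqType) (r : seq I) (P : pred I)
    (F : I -> R) (j : I) :
  (forall i, i \in r -> P i -> 0 <= F i) -> j \in r -> P j -> 0 < F j ->
  0 < \sum_(i <- r | P i) F i.
Proof.
move=> F0 jr Pj Fj; rewrite (perm_big _ (perm_to_rem jr)) big_cons Pj.
rewrite ltr_pwDl // big_seq_cond sumr_ge0 // => i /andP[/mem_rem ir Pi].
exact: F0.
Qed.

Lemma sumr_seq_exists_gt0 (R : realDomainType) (I : eqType) (r : seq I)
    (P : pred I) (F : I -> R) :
  0 < \sum_(i <- r | P i) F i -> exists i, [/\ i \in r, P i & 0 < F i].
Proof.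
move=> F0; apply/not_existsP => noF; move: F0; apply/negP; rewrite -leNgt.
rewrite big_seq_cond sumr_le0 // => i /andP[ir Pi]; rewrite leNgt.
by apply/negP => Fi; apply: (noF i).
Qed.

Lemma sum_rem (V : nmodType) (I : eqType) (r : seq I) (F : I -> V) (j : I) :
  j \in r -> \sum_(i <- r) F i = F j + \sum_(i <- rem j r) F i.
Proof. by move=> jr; rewrite (perm_big _ (perm_to_rem jr)) big_cons. Qed.

Lemma mem_rem_or (I : eqType) (r : seq I) (i j : I) :
  j \in r -> i \in r -> i = j \/ i \in rem j r.
Proof.
move=> jr; rewrite (perm_mem (perm_to_rem jr)) inE => /predU1P[->|]; first by left.
by right.
Qed.

End SeqSums.

Section Affine.
Context {R : realType} {n : nat}.

Definition aff (g : 'rV[R]_n * int) (x : 'rV[R]_n) : R := dotp x g.1 - g.2%:~R.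

(** Negative levels are included: [(a, m)] and [(-a, -m)] define the same hyperplane, so each one
    occurs with both orientations. *)
Definition level (Phi : seq 'rV[R]_n) (k : nat) (g : 'rV[R]_n * int) : bool :=
  (g.1 \in Phi) && (`|g.2| <= k%:Z).

Definition above (Phi : seq 'rV[R]_n) (k : nat) (x : 'rV[R]_n)
  (g : 'rV[R]_n * int) : bool := level Phi k g && (0 < aff g x).

Definition regular (Phi : seq 'rV[R]_n) (k : nat) (x : 'rV[R]_n) : Prop :=
  forall g, level Phi k g -> aff g x != 0.

End Affine.

(** For [s = 1], [a - c = t - b] lies between 0 and [a], and [b - c = t - a] lies between [- a] and
    0. Negating all levels gives the other sign. *)
Lemma level_sub_bound (s a b c t K : int) : s = 1 \/ s = -1 ->
  a + b = c + t -> 0 <= s * t -> s * b <= 0 -> 0 < s * c -> `|a| <= K ->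
  `|a - c| <= K /\ `|b - c| <= K.
Proof. by case=> ->; lia. Qed.

Lemma level_add_bound (s a b K : int) : s = 1 \/ s = -1 ->
  0 <= s * a -> s * b <= 0 -> `|a| <= K -> `|b| <= K -> `|a + b| <= K.
Proof. by case=> ->; lia. Qed.

(** Here [m] is the level of the function that replaces a difference. It may exceed the exact level
    [b - a], but equality in the new relation rules this out. *)
Lemma cancel_level (a b S T m : int) : a + S <= b + T -> b - a <= m ->
  S <= m + T /\ (S = m + T -> m = b - a).
Proof. by lia. Qed.

Lemma absorb_level (c S T m : int) : S <= c + T -> c <= m ->
  S <= m + T /\ (S = m + T -> m = c).
Proof. by lia. Qed.

Section WallRelations.
Context {R : realType} {n : nat} {Phi : seq 'rV[R]_n} {k : nat}.
Hypothesis root_system : is_cryst_root_system Phi.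
Context {x : 'rV[R]_n}.
Hypothesis x_regular : regular Phi k x.
Notation affine := ('rV[R]_n * int)%type.
Notation above := (above Phi k x).
Implicit Types (f g h : affine) (F G : seq affine).

(** If the gradient is positive at [x], a negative level is implied by level 0 and is left out. What
    remains has levels and gradients at [x] of matching sign. *)
Definition essential g : bool := above g && ((dotp x g.1 < 0) || (0 <= g.2)).

(* [s = 1] describes the floors [(a, i)] and [s = -1] the ceilings [(-a, -i)]
   of the region of [x]. *)
Definition wall_like (s : int) f : Prop :=
  [/\ above f, 0 < s * f.2, 0 < s%:~R * dotp x f.1,
      forall m, above (f.1, m) -> m <= f.2 &
      forall g h, above g -> above h -> (g.1 + h.1, g.2 + h.2) <> f].

Lemma aboveP g : level Phi k g -> above g \/ above (- g.1, - g.2).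
Proof.
move=> gl; have := x_regular gl; rewrite neq_lt => /orP[g0|g0]; last first.
  by left; rewrite /above gl.
right; rewrite /above /level /aff /= dotpNr rmorphN opprK normrN.
case/andP: gl => /(opp_root root_system) -> -> /=.
by move: g0; rewrite /aff; lra.
Qed.

Lemma above_level g : above g -> level Phi k g.
Proof. by case/andP. Qed.

Lemma above_root g : above g -> g.1 \in Phi.
Proof. by case/andP => /andP[]. Qed.

Lemma above_norm g : above g -> `|g.2| <= k%:Z.
Proof. by case/andP => /andP[]. Qed.

Lemma above_lt g : above g -> g.2%:~R < dotp x g.1.
Proof. by case/andP => _; rewrite /aff subr_gt0. Qed.

Lemma above_neg g : above g -> dotp x g.1 < 0 -> g.2 < 0.
Proof. by move=> /above_lt g0 xg; rewrite -(ltrz0 R); apply: lt_trans xg. Qed.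

Lemma essential_ex g : above g ->
  exists m, essential (g.1, m) /\ g.2 <= m.
Proof.
move=> ga; have [xg|xg] := ltP (dotp x g.1) 0.
  by exists g.2; rewrite /essential -surjective_pairing ga xg.
have [m0|m0] := leP 0 g.2.
  by exists g.2; rewrite /essential -surjective_pairing ga m0 orbT.
exists 0; rewrite /essential lexx orbT andbT /above /level /= normr0 lez_nat.
rewrite (above_root ga) ltW //; split=> //.
have := @x_regular (g.1, 0); rewrite /level /= (above_root ga) normr0 => /(_ isT).
by rewrite /aff /= subr0 => xg0; rewrite lt_def xg0 xg.
Qed.

(** The level bound puts [g - f] in the arrangement, so it has a sign at [x]. Were it negative,
    [f = g + (f - g)] would decompose the wall. *)
Lemma wall_like_sub s f g : wall_like s f -> above g -> 0 < dotp f.1 g.1 ->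
  f.1 != g.1 -> `|g.2 - f.2| <= k%:Z -> above (g.1 - f.1, g.2 - f.2).
Proof.
move=> [fa _ _ _ f_indec] ga fg0 f_neq_g gfk.
have gfl : level Phi k (g.1 - f.1, g.2 - f.2).
  rewrite /level /= gfk andbT (root_sub root_system) ?above_root //.
    by rewrite dotpC.
  by rewrite eq_sym.
have [//|/= fga] := aboveP gfl.
have [] := f_indec _ _ ga fga.
by rewrite /= !opprB !subrKC -surjective_pairing.
Qed.

Lemma above_add g h : above g -> above h -> dotp g.1 h.1 < 0 ->
  h.1 != - g.1 -> `|g.2 + h.2| <= k%:Z -> above (g.1 + h.1, g.2 + h.2).
Proof.
move=> ga ha gh0 gNh ghk; rewrite /above /level /= ghk andbT.
have -> : g.1 + h.1 \in Phi.
  rewrite -[h.1]opprK (root_sub root_system) ?above_root //.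
  - exact/(opp_root root_system)/above_root.
  - by rewrite dotpNr oppr_gt0.
  - by rewrite eq_sym eqr_oppLR.
have := above_lt ga; have := above_lt ha.
by rewrite /aff /= dotpDr rmorphD /=; lra.
Qed.

Section Sign.
Context {s : int}.
Hypothesis s_sign : s = 1 \/ s = -1.
Notation wall_like := (wall_like s).
Notation side v := (s%:~R * dotp x v).

Lemma side_sum F : side (\sum_(f <- F) f.1) = \sum_(f <- F) side f.1.
Proof. by rewrite dotp_sumr mulr_sumr. Qed.

Lemma side_neq0 g : level Phi k g -> side g.1 != 0.
Proof.
move=> /andP[gPhi _].
have : aff (g.1, 0) x != 0 by apply: x_regular; rewrite /level /= gPhi normr0.
rewrite /aff subr0 => xg0; apply: mulf_neq0 => //.
by case: s_sign => ->; rewrite ?mulr1z ?mulrN1z ?oppr_eq0 oner_eq0.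
Qed.

Lemma essential_side_gt0 g : essential g -> 0 < side g.1 -> 0 <= s * g.2.
Proof.
case/andP => ga gs; case: s_sign => ->; rewrite ?mul1r ?mulN1r ?mulrN1z ?mulN1r => xg.
  by move: gs; rewrite ltNge ltW.
by rewrite oppr_ge0 ltW // above_neg // -oppr_gt0.
Qed.

Lemma essential_side_lt0 g : essential g -> side g.1 < 0 -> s * g.2 <= 0.
Proof.
case/andP => ga gs; case: s_sign => ->; rewrite ?mul1r ?mulN1r ?mulrN1z ?mulN1r => xg.
  by rewrite ltW // above_neg.
by move: gs; rewrite oppr_lt0 in xg *; rewrite ltNge ltW //= oppr_le0.
Qed.

Lemma wall_like_sum_side F : (forall f, f \in F -> wall_like f) ->
  0 <= side (\sum_(f <- F) f.1).
Proof.
move=> FW; rewrite side_sum big_seq sumr_ge0 // => f /FW[_ _ + _ _].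
exact: ltW.
Qed.

Lemma wall_like_sum_level F : (forall f, f \in F -> wall_like f) ->
  0 <= s * \sum_(f <- F) f.2.
Proof.
move=> FW; rewrite mulr_sumr big_seq sumr_ge0 // => f /FW[_ + _ _ _].
exact: ltW.
Qed.

Lemma sum_pair_eq0 g h : above g -> above h -> g.1 + h.1 = 0 -> g.2 + h.2 < 0.
Proof.
move=> /above_lt g0 /above_lt h0 gh0; rewrite -(ltrz0 R) rmorphD /=.
have := dotp0r x; rewrite -gh0 dotpDr; lra.
Qed.

(** Some wall has positive product with the common gradient, hence with that of [g] or [h], and is
    subtracted from it; [h] stays on the negative side. With no wall left, [g + h] would vanish
    although both are positive at [x]. *)
Lemma no_mixed_sum F g h : (forall f, f \in F -> wall_like f) ->
  above g -> above h -> side h.1 < 0 -> s * h.2 <= 0 ->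
  g.1 + h.1 = \sum_(f <- F) f.1 -> g.2 + h.2 = \sum_(f <- F) f.2 -> False.
Proof.
have [N] := ubnP (size F); elim: N F g h => // N IH F g h /ltnSE FN FW ga ha hs hl.
have [->|F_neq0] := eqVneq F [::].
  by rewrite !big_nil => /(sum_pair_eq0 ga ha); lia.
set u := \sum_(f <- F) f.1 => gh1 gh2.
have u_neq0 : u != 0.
  move=> {gh1 gh2 FN}; case: F FW F_neq0 @u => // f F FW _ u; apply/eqP => u0.
  have := congr1 (fun v => side v) u0.
  rewrite /u big_cons dotp0r mulr0 dotpDr mulrDr.
  have [_ _ f0 _ _] := FW f (mem_head _ _).
  have /wall_like_sum_side : forall f', f' \in F -> wall_like f'.
    by move=> f' f'F; apply: FW; rewrite inE f'F orbT.
  by lra.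
have [f [fF _]] : exists f, [/\ f \in F, true & 0 < dotp u f.1].
  by apply: sumr_seq_exists_gt0; rewrite -dotp_sumr dotpp_gt0.
have f_wall := FW f fF; have [fa fl fs _ _] := f_wall.
have rem_wall f' : f' \in rem f F -> wall_like f' by move/mem_rem/FW.
have rem_size : (size (rem f F) < N)%N.
  by move: FN; rewrite size_rem // -ltnS prednK //; case: (F) fF.
have := wall_like_sum_level rem_wall; have := wall_like_sum_side rem_wall.
move: gh1 gh2; rewrite /u !(sum_rem _ fF) => gh1 gh2 rs rl.
have gk := above_norm ga; have hk := above_norm ha; have fk := above_norm fa.
rewrite -gh1 dotpDl => uf0.
have [gf0|gf0] := ltP 0 (dotp g.1 f.1).
  have [fg|fg] := eqVneq f.1 g.1.
    move: gh1; rewrite fg => /addrI h1; move: rs; rewrite -h1; lra.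
  have gfa : above (g.1 - f.1, g.2 - f.2).
    apply: wall_like_sub f_wall ga _ fg _; first by rewrite dotpC.
    by case: (level_sub_bound s_sign gh2 rl hl fl gk).
  apply: (IH (rem f F) _ h rem_size rem_wall gfa ha) => //=.
    by rewrite addrAC gh1 addrAC subrr add0r.
  by rewrite addrAC gh2 addrAC subrr add0r.
have fh : f.1 != h.1 by apply/eqP => fh; move: fs; rewrite fh; lra.
have hfa : above (h.1 - f.1, h.2 - f.2).
  apply: wall_like_sub f_wall ha _ fh _; first by rewrite dotpC; lra.
  by case: (level_sub_bound s_sign gh2 rl hl fl gk).
apply: (IH (rem f F) g _ rem_size rem_wall ga hfa) => /=.
- by rewrite dotpBr mulrBr; lra.
- by rewrite mulrBr subr_le0 (le_trans hl (ltW fl)).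
- by rewrite addrA gh1 addrAC subrr add0r.
- by rewrite addrA gh2 addrAC subrr add0r.
Qed.

Definition wall_sum g : Prop := exists F,
  [/\ forall f, f \in F -> wall_like f,
      g.1 = \sum_(f <- F) f.1 & g.2 = \sum_(f <- F) f.2].

(** This part of [G] equals the walls plus the negated rest of [G], and every term counts
    positively. It is the nonzero vector on which each rewriting step relies. *)
Lemma left_positive F G : (forall f, f \in F -> wall_like f) ->
  (forall g, g \in G -> essential g) -> (0 < size F + size G)%N ->
  \sum_(f <- F) f.1 = \sum_(g <- G) g.1 ->
  0 < side (\sum_(g <- G | 0 < side g.1) g.1).
Proof.
move=> FW GE FG0 FGE.
have uE : side (\sum_(g <- G | 0 < side g.1) g.1) =
    \sum_(f <- F) side f.1 + \sum_(g <- G | ~~ (0 < side g.1)) - side g.1.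
  rewrite sumrN -side_sum FGE (bigID (fun g => 0 < side g.1) xpredT) /=.
  by rewrite dotpDr mulrDr -!mulr_sumr -!dotp_sumr addrK.
have G0 g : g \in G -> ~~ (0 < side g.1) -> 0 <= - side g.1.
  by move=> _; rewrite oppr_ge0 -leNgt.
have F0 f : f \in F -> 0 < side f.1 by case/FW.
have F0' f : f \in F -> true -> 0 <= side f.1 by move=> /F0/ltW.
have FS : 0 <= \sum_(f <- F) side f.1.
  by rewrite big_seq sumr_ge0 // => f /F0'; apply.
have GS : 0 <= \sum_(g <- G | ~~ (0 < side g.1)) - side g.1.
  by rewrite big_seq_cond sumr_ge0 // => g /andP[]; apply: G0.
case: F FG0 {FW FGE} uE F0 F0' FS => [/=|f F _ uE F0 F0' _]; last first.
  rewrite uE ltr_pwDl //; apply: (sumr_seq_gt0 F0' (mem_head _ _)) => //.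
  exact/F0/mem_head.
rewrite add0n -has_predT => /hasP[g gG _] uE _ _ _.
have [gs|gs] := boolP (0 < side g.1).
  rewrite dotp_sumr mulr_sumr; apply: (sumr_seq_gt0 _ gG) => // i _.
  exact: ltW.
rewrite uE big_nil add0r; apply: (sumr_seq_gt0 G0 gG gs).
rewrite oppr_gt0 lt_neqAle leNgt gs andbT side_neq0 //.
by case/andP: (GE g gG) => /above_level.
Qed.

(* Multiset rewriting: subtracting a wall from a function of the same side, or
   adding two functions of opposite sides, stays within the levels [-k..k]. *)
Lemma wall_sum_dominates F G : (forall f, f \in F -> wall_like f) ->
  (forall g, g \in G -> essential g) ->
  \sum_(f <- F) f.1 = \sum_(g <- G) g.1 ->
  \sum_(f <- F) f.2 <= \sum_(g <- G) g.2 ->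
  \sum_(f <- F) f.2 = \sum_(g <- G) g.2 /\ (forall g, g \in G -> wall_sum g).
Proof.
have [N] := ubnP (size F + size G); elim: N F G => // N IH F G /ltnSE FGN FW GE.
move=> FG1 FG2; have [FG0|FG0] := posnP (size F + size G).
  by case: F G FG0 {FGN FW GE FG1 FG2} => [|//] [|//] _; rewrite !big_nil.
have u_neq0 : \sum_(g <- G | 0 < side g.1) g.1 != 0.
  apply/eqP => u0; have := left_positive FW GE FG0 FG1.
  by rewrite u0 dotp0r mulr0 ltxx.
move: u_neq0; rewrite -dotpp_gt0 dotp_sumr => /sumr_seq_exists_gt0[g [gG gs]].
set u := \sum_(g <- G | _) _; rewrite dotpC => gu0.
have /andP[ga _] := GE g gG.
have gl := essential_side_gt0 (GE g gG) gs.
have gk := above_norm ga.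
have rG_ess h : h \in rem g G -> essential h by move/mem_rem/GE.
have rG_size : (size (rem g G)).+1 = size G.
  by rewrite size_rem // prednK //; case: (G) gG.
have uE : u = \sum_(f <- F) f.1 + \sum_(h <- G | ~~ (0 < side h.1)) - h.1.
  by rewrite sumrN FG1 (bigID (fun h => 0 < side h.1) xpredT) /= addrK.
(* Since [u] is the sum of the walls and of the negated functions of the other side, one of these
   terms has positive product with [g]. *)
have {gu0 uE}[[f [fF fg0]]|[h [hG hs gh0]]] :
    (exists f, f \in F /\ 0 < dotp f.1 g.1) \/
    (exists h, [/\ h \in G, ~~ (0 < side h.1) & dotp g.1 h.1 < 0]).
  move: gu0; rewrite uE dotpDr !dotp_sumr => gu0.
  have [/sumr_seq_exists_gt0[f [fF _ fg]]|F0] := ltP 0 (\sum_(f <- F) dotp g.1 f.1).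
    by left; exists f; rewrite dotpC.
  have /sumr_seq_exists_gt0[h [hG hs hg]] :
      0 < \sum_(h <- G | ~~ (0 < side h.1)) dotp g.1 (- h.1) by lra.
  by right; exists h; split=> //; rewrite -oppr_gt0 -dotpNr.
- have f_wall := FW f fF; have [fa fl fs fmax _] := f_wall.
  have fk := above_norm fa.
  have rF_wall f' : f' \in rem f F -> wall_like f' by move/mem_rem/FW.
  have rF_size : (size (rem f F)).+1 = size F.
    by rewrite size_rem // prednK //; case: (F) fF.
  move: FG1 FG2; rewrite !(sum_rem _ fF) !(sum_rem _ gG) => FG1 FG2.
  (* Equal gradients cancel. The level of the wall [f] is maximal for its gradient, and equality in
     the shorter relation makes both levels equal. *)
  have [fg|fg] := eqVneq f.1 g.1.
    have gf2 : g.2 <= f.2 by apply: fmax; rewrite fg -surjective_pairing.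
    have [|rFG_le rFG_eq] := cancel_level (m := 0) FG2; first by rewrite subr_le0.
    have [|||||rFG rGC] := IH (rem f F) (rem g G) => //.
    + by move: FGN; rewrite -rF_size -rG_size addSn addnS => /ltnW.
    + by move: FG1; rewrite fg => /addrI.
    + by rewrite add0r in rFG_le.
    have fgE : f.2 = g.2.
      by apply/esym/eqP; rewrite -subr_eq0 -rFG_eq ?add0r.
    split=> [|h /(mem_rem_or gG)[->|/rGC//]]; first by rewrite rFG fgE.
    by exists [:: f]; rewrite !big_seq1; split=> // f'; rewrite inE => /eqP->.
  have gfa : above (g.1 - f.1, g.2 - f.2).
    apply: wall_like_sub f_wall ga fg0 fg _.
    apply: (level_add_bound s_sign gl _ gk); last by rewrite normrN.
    by rewrite mulrN oppr_le0 ltW.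
  have [m [gf_ess /= gfm]] := essential_ex gfa.
  have [rFG_le rFG_eq] := cancel_level FG2 gfm.
  have [|||||FGE rGC] := IH (rem f F) ((g.1 - f.1, m) :: rem g G) => //.
  + by move: FGN; rewrite -rF_size -rG_size addSn.
  + by move=> h; rewrite inE => /predU1P[->//|/rG_ess].
  + rewrite big_cons /= addrAC -FG1 addrAC subrr add0r //.
  + by rewrite big_cons.
  move: FGE; rewrite big_cons /= => FGE.
  have mE := rFG_eq FGE.
  split=> [|h /(mem_rem_or gG)[->|hG]]; last by apply: rGC; rewrite inE hG orbT.
    by rewrite FGE mE addrA subrKC.
  have [H [HW H1 H2]] := rGC _ (mem_head _ _).
  exists (f :: H); rewrite !big_cons -H1 -H2 /= mE !subrKC; split=> //.
  by move=> f'; rewrite inE => /predU1P[->|/HW].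
- have /andP[ha _] := GE h hG; have hk := above_norm ha.
  have {}hs : side h.1 < 0.
    by rewrite lt_neqAle leNgt hs andbT side_neq0 // above_level.
  have hl := essential_side_lt0 (GE h hG) hs.
  have hrG : h \in rem g G.
    by have [hg|//] := mem_rem_or gG hG; rewrite hg ltNge (ltW gs) in hs.
  have rrG_size : (size (rem h (rem g G))).+2 = size G.
    by rewrite size_rem // -rG_size prednK //; case: (rem g G) hrG.
  have rrG_ess h' : h' \in rem h (rem g G) -> essential h' by move/mem_rem/rG_ess.
  move: FG1 FG2; rewrite !(sum_rem _ gG) !(sum_rem _ hrG) !addrA => FG1 FG2.
  (* Opposite gradients cancel and their levels have a negative sum, so the shorter relation would
     be strict, against the induction hypothesis. *)
  have [hg|hg] := eqVneq h.1 (- g.1).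
    have gh : g.1 + h.1 = 0 by rewrite hg subrr.
    have gh2 := sum_pair_eq0 ga ha gh.
    have [rFG_le rFG_eq] := absorb_level (m := 0) FG2 (ltW gh2).
    have [|||||FGE _] := IH F (rem h (rem g G)) => //.
    + by move: FGN; rewrite -rrG_size !addnS => /ltnW.
    + by rewrite FG1 gh add0r.
    + by rewrite add0r in rFG_le.
    by move: gh2; rewrite -rFG_eq ?add0r ?ltxx.
  have gha : above (g.1 + h.1, g.2 + h.2).
    apply: above_add => //.
    exact: (level_add_bound s_sign gl).
  have [m [gh_ess /= ghm]] := essential_ex gha.
  have [rFG_le rFG_eq] := absorb_level FG2 ghm.
  have [|||||FGE rGC] := IH F ((g.1 + h.1, m) :: rem h (rem g G)) => //.
  + by move: FGN; rewrite -rrG_size !addnS.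
  + by move=> h'; rewrite inE => /predU1P[->//|/rrG_ess].
  + by rewrite big_cons.
  + by rewrite big_cons.
  move: FGE; rewrite big_cons /= => FGE.
  have mE := rFG_eq FGE.
  have [H [HW /= H1 H2]] := rGC _ (mem_head _ _).
  (* By induction [g + h] would be a sum of walls, so this case never occurs. *)
  by case: (no_mixed_sum HW ga ha hs hl H1); rewrite -mE.
Qed.

End Sign.
End WallRelations.

(** * Points of the closed region on all the given walls *)

Lemma certificate_level (N c : nat) (S T : int) : N%:Z = T - S - c%:Z ->
  S <= T /\ ((0 < N)%N -> S <> T).
Proof. by lia. Qed.

Section FacePoint.
Context {R : realType} {n : nat} {Phi : seq 'rV[R]_n} {k : nat}.
Hypothesis root_system : is_cryst_root_system Phi.
Notation affine := ('rV[R]_n * int)%type.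

Definition levels : seq affine :=
  [seq (a, i%:Z - k%:Z) | a <- Phi, i <- iota 0 (k + k).+1].

Lemma mem_levels (g : affine) : (g \in levels) = level Phi k g.
Proof.
apply/allpairsP/andP => [[[a i] [aPhi + ->]]|[gPhi gk]].
  by rewrite mem_iota /= => ik; split=> //=; lia.
have [i [ik gE]] : exists i : nat, (i < (k + k).+1)%N /\ g.2 = i%:Z - k%:Z.
  by exists (absz (g.2 + k%:Z)%R); lia.
exists (g.1, i); rewrite mem_iota /= ik -gE; split=> //.
exact: surjective_pairing.
Qed.

Context {x : 'rV[R]_n} {s : int}.
Hypothesis x_regular : regular Phi k x.
Hypothesis s_sign : s = 1 \/ s = -1.
Notation wall_like := (@wall_like _ _ Phi k x s).
Notation essential := (@essential _ _ Phi k x).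

Let neg (g : affine) : affine := (- g.1, - g.2).

(* [(0, -1)] stands for the inequality [1 >= 0]. *)
Let system (M : seq affine) : seq affine :=
  [seq g <- levels | essential g] ++ map neg M ++ [:: (0, -1)].

Lemma mem_system M g : g \in system M ->
  [\/ essential g, exists2 f, f \in M & g = neg f | g = (0, -1)].
Proof.
rewrite !mem_cat mem_filter inE => /or3P[/andP[? _]|/mapP[f fM ->]|/eqP ->].
- by apply: Or31.
- by apply: Or32; exists f.
- exact: Or33.
Qed.

Lemma system_root M g : (forall f, f \in M -> wall_like f) -> g \in system M ->
  g.1 \in 0 :: Phi.
Proof.
move=> MW /mem_system[/andP[/above_root gPhi _]|[f /MW[fa _ _ _ _] ->]|->].
- by rewrite inE gPhi orbT.
- by rewrite inE (opp_root root_system) ?orbT // (above_root fa).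
- exact: mem_head.
Qed.

Lemma certificate_split M (C : seq affine) : {subset C <= system M} ->
  exists F G (c : nat), [/\ {subset F <= M}, forall g, g \in G -> essential g,
    \sum_(g <- C) g.1 = \sum_(g <- G) g.1 - \sum_(f <- F) f.1 &
    \sum_(g <- C) g.2 = \sum_(g <- G) g.2 - \sum_(f <- F) f.2 - c%:Z].
Proof.
elim: C => [_|g C IH CA].
  by exists [::], [::], 0%N; rewrite !big_nil !subr0; split.
have [|F [G [c [FM GE E1 E2]]]] := IH.
  by move=> h hC; apply: CA; rewrite inE hC orbT.
have [gE|[f fM ->]|->] := mem_system (CA g (mem_head _ _)).
- exists F, (g :: G), c; rewrite !big_cons E1 E2 !addrA; split=> // h.
  by rewrite inE => /predU1P[->|/GE].
- exists (f :: F), G, c; rewrite !big_cons E1 E2 /=; split=> //.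
  + by move=> h; rewrite inE => /predU1P[->|/FM].
  + by rewrite opprD addrCA.
  + by rewrite opprD !addrA; congr (_ - _ - _); rewrite addrC.
- exists F, G, c.+1; rewrite !big_cons E1 E2 /= add0r; split=> //.
  by rewrite -[c.+1]addn1 PoszD opprD [RHS]addrA [RHS]addrC.
Qed.

(** Two Farkas alternatives: one makes [v] positive, the other the homogenising coordinate. A
    certificate against either contradicts [wall_sum_dominates]. *)
Lemma face_point (M : seq affine) (v : 'rV[R]_n) :
  (forall f, f \in M -> wall_like f) -> v \in Phi -> 0 < dotp x v ->
  exists p, [/\ forall f, f \in M -> aff f p = 0,
    forall g, above Phi k x g -> 0 <= aff g p & 0 < dotp p v].
Proof.
move=> MW vPhi xv.
have vNPhi := opp_root root_system vPhi.
have v_ess : essential (v, 0).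
  by rewrite /essential /above /level /aff /= vPhi normr0 subr0 xv lexx orbT.
have sysPhi (g0 : affine) : g0.1 \in 0 :: Phi ->
    forall g, g \in g0 :: system M -> g.1 \in 0 :: Phi.
  by move=> g0Phi g; rewrite inE => /predU1P[->//|/(system_root MW)].
have [||[p1 [t1 [p1A p1v]]]|[N [C [N0 CA C1 C2]]]] :=
    @affine_farkas _ _ _ root_system (system M) (- v, 0).
- by apply: sysPhi; rewrite inE vNPhi orbT.
- by rewrite /= opprK inE vPhi orbT.
- have [||[p2 [t2 [p2A p2v]]]|[N [C [N0 CA C1 C2]]]] :=
      @affine_farkas _ _ _ root_system (system M) (0, 1).
  + by apply: sysPhi; exact: mem_head.
  + by rewrite /= oppr0 mem_head.
  + have one_sys : (0, -1) \in system M by rewrite !mem_cat inE eqxx !orbT.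
    have t2_gt0 : 0 < t2 by move: p2v; rewrite /= dotp0r mulr1; lra.
    have t1_ge0 : 0 <= t1.
      by have := p1A _ one_sys; rewrite /= dotp0r mulrN1z; lra.
    have t_gt0 : 0 < t1 + t2 by lra.
    (* As [t1] may be 0, [p1] may be only a direction; adding the solution with [t2] positive gives
       a genuine point. *)
    pose p := (t1 + t2)^-1 *: (p1 + p2).
    have affE g : aff g p = (t1 + t2)^-1 *
        ((dotp p1 g.1 - t1 * g.2%:~R) + (dotp p2 g.1 - t2 * g.2%:~R)).
      by rewrite /aff /p dotpZl dotpDl; field; rewrite gt_eqF.
    have p_ge0 g : g \in system M -> 0 <= aff g p.
      move=> gA; rewrite affE; apply: mulr_ge0; first by rewrite invr_ge0 ltW.
      by apply: addr_ge0; [exact: p1A|exact: p2A].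
    have p_above g : above Phi k x g -> 0 <= aff g p.
      move=> ga; have [m [mE gm]] := essential_ex x_regular ga.
      have : 0 <= aff (g.1, m) p.
        apply: p_ge0; rewrite mem_cat mem_filter mE mem_levels.
        by case/andP: mE => /above_level ->.
      by rewrite /aff /=; move: gm; rewrite -(ler_int R); lra.
    exists p; split=> //.
    * move=> f fM; have [fa _ _ _ _] := MW f fM; apply/eqP.
      rewrite eq_le p_above // andbT -oppr_ge0.
      have -> : - aff f p = aff (neg f) p.
        by rewrite /aff /= dotpNr rmorphN opprB opprK addrC.
      by apply: p_ge0; rewrite !mem_cat map_f ?orbT.
    * have := p2A (v, 0); rewrite /= mulr0 subr0 mem_cat mem_filter v_ess.
      rewrite mem_levels /level /= vPhi normr0 /= => /(_ isT) p2v0.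
      rewrite /p dotpZl mulr_gt0 ?invr_gt0 // dotpDl.
      by move: p1v; rewrite /= dotpNr mulr0; lra.
  (* Walls and essential functions have equal total gradients here, but a strict inequality between
     levels. *)
  + have [F [G [c [FM GE E1 E2]]]] := certificate_split CA.
    have [FG_le FG_neq] := certificate_level (etrans (esym (natz N)) (etrans C2 E2)).
    have [||||FGE _] :=
      @wall_sum_dominates _ _ _ _ root_system _ x_regular _ s_sign F G.
    * by move=> f /FM/MW.
    * exact: GE.
    * by apply/eqP; rewrite eq_sym -subr_eq0 -E1 -C1 mul0rn.
    * exact: FG_le.
    by case: (FG_neq N0).
(* The copies of [(v, 0)] join the essential functions, so [(v, 0)] is a sum of walls. The sum is
   nonempty since [<x, v>] is positive, yet its level has strict sign [s]. *)
- have [F [G [c [FM GE E1 E2]]]] := certificate_split CA.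
  have [||||_ vG] := @wall_sum_dominates _ _ _ _ root_system _ x_regular _ s_sign
      F (nseq N (v, 0) ++ G).
  + by move=> f /FM/MW.
  + by move=> g; rewrite mem_cat => /orP[/nseqP[->]|/GE].
  + rewrite big_cat big_nseq iter_addr addr0 /=.
    move: C1; rewrite E1 /= mulNrn => /eqP; rewrite eqr_oppLR opprB => /eqP ->.
    by rewrite subrK.
  + rewrite big_cat big_nseq iter_addr addr0 /=.
    have [] := @certificate_level 0 c (\sum_(f <- F) f.2) (\sum_(g <- G) g.2).
      by rewrite -E2 -C2 mul0rn.
    by rewrite mul0rn add0r.
  have [|H [HW /= H1 H2]] := vG (v, 0).
    by rewrite mem_cat mem_nseq N0 eqxx.
  case: H HW H1 H2 => [|f H] HW H1 H2.
    by move: xv; rewrite H1 big_nil dotp0r ltxx.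
  have [_ fs _ _ _] := HW f (mem_head _ _).
  have Hs : 0 <= s * \sum_(h <- H) h.2.
    by apply: (@wall_like_sum_level _ _ _ _ x) => h hH; apply: HW; rewrite inE hH orbT.
  have : 0 < s * (f.2 + \sum_(h <- H) h.2) by rewrite mulrDr ltr_pwDl.
  by move: H2; rewrite big_cons => <-; rewrite mulr0 ltxx.
Qed.

End FacePoint.

(** * Regions and walls *)

Section SignLemmas.
Context {R : realFieldType}.
Implicit Types a b c : R.

Lemma mulr_sign_ge0 a b c : 0 < a * b -> 0 <= a * c -> 0 <= b * c.
Proof.
move=> ab ac; have a0 : a != 0 by apply: contraTneq ab => ->; rewrite mul0r ltxx.
have aa : 0 < a * a by rewrite -expr2 exprn_even_gt0.
by rewrite -(pmulr_rge0 _ aa) mulrACA mulr_ge0 // ltW.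
Qed.

Lemma mulr_sign_gt0 a b c : 0 < a * b -> 0 < a * c -> 0 < b * c.
Proof.
move=> ab ac; have a0 : a != 0 by apply: contraTneq ab => ->; rewrite mul0r ltxx.
have aa : 0 < a * a by rewrite -expr2 exprn_even_gt0.
by rewrite -(pmulr_rgt0 _ aa) mulrACA mulr_gt0.
Qed.

End SignLemmas.

Section Lines.
Context {R : realType} {n : nat}.
Notation affine := ('rV[R]_n * int)%type.
Implicit Types (g : affine) (p q x y : 'rV[R]_n).

Lemma aff_line g p q t :
  aff g (p + t *: (q - p)) = (1 - t) * aff g p + t * aff g q.
Proof. by rewrite /aff dotpDl dotpZl dotpBl; ring. Qed.

Lemma continuous_aff g : continuous (aff g).
Proof.
move=> x; apply: (@cvgB _ _ _ (nbhs x) _ (fun y => dotp y g.1)).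
  exact: continuous_dotp.
exact: cvg_cst.
Qed.

Lemma continuous_line p q : continuous (fun t : R => p + t *: (q - p)).
Proof.
by move=> t; apply: cvgD; [exact: cvg_cst|apply: cvgZr_tmp; exact: cvg_id].
Qed.

Lemma near_line p q (B : set 'rV[R]_n) : nbhs p B ->
  exists2 e : R, 0 < e & forall t, `|t| <= e -> B (p + t *: (q - p)).
Proof.
move=> Bp; have := @continuous_line p q 0 B.
rewrite scale0r addr0 => /(_ Bp) /nbhs_ballP[e /= e0 eB].
exists (e / 2); first by rewrite divr_gt0.
move=> t te; apply: (eB t); rewrite /ball /= sub0r normrN.
by rewrite (le_lt_trans te) // gtr_pMr // invf_lt1 // ltr1n.
Qed.

Lemma near_seq (I : eqType) (L : seq I) x (Q : I -> 'rV[R]_n -> Prop) :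
  (forall i, i \in L -> \forall y \near x, Q i y) ->
  \forall y \near x, forall i, i \in L -> Q i y.
Proof.
elim: L => [_|i L IH LQ]; first exact: (@filterE _ _ (nbhs_filter x)).
have Qi : \forall y \near x, Q i y by apply: LQ; rewrite mem_head.
have QL : \forall y \near x, forall i, i \in L -> Q i y.
  by apply: IH => j jL; apply: LQ; rewrite inE jL orbT.
apply: (@filterS2 _ _ (nbhs_filter x) _ _ _ _ Qi QL) => y Qiy QLy j.
by rewrite inE => /predU1P[->|/QLy].
Qed.

Lemma near_aff_sign (L : seq affine) p (c : affine -> R) :
  (forall g, g \in L -> 0 < c g * aff g p) ->
  \forall y \near p, forall g, g \in L -> 0 < c g * aff g y.
Proof.
move=> cL; apply: near_seq => g gL.
have cg : continuous (fun y => c g * aff g y).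
  by move=> y; exact: (@cvgMl_tmp _ _ _ (nbhs_filter y) _ _ _ (@continuous_aff g y)).
have oc := @open_comp _ _ _ [set z : R | 0 < z] (in1W cg) (@open_gt R 0).
by apply: open_nbhs_nbhs; split=> //; exact: cL.
Qed.

End Lines.

(** * Regions as sets of points with a given sign vector *)

Section Cells.
Context {R : realType} {n : nat} {Phi : seq 'rV[R]_n} {k : nat}.
Hypothesis root_system : is_cryst_root_system Phi.
Notation affine := ('rV[R]_n * int)%type.
Notation regular := (regular Phi k).
Implicit Types (g f : affine) (p q x y : 'rV[R]_n).

Definition cell x : set 'rV[R]_n :=
  [set y | forall g, level Phi k g -> 0 < aff g x * aff g y].

Definition closed_cell x : set 'rV[R]_n :=
  [set y | forall g, level Phi k g -> 0 <= aff g x * aff g y].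

Definition opp_aff g : affine := (- g.1, - g.2).

Lemma aff_opp g x : aff (opp_aff g) x = - aff g x.
Proof. by rewrite /aff /= dotpNr rmorphN opprB opprK addrC. Qed.

Lemma opp_affK : involutive opp_aff.
Proof. by case=> a m; rewrite /opp_aff /= !opprK. Qed.

Lemma level_opp g : level Phi k g -> level Phi k (opp_aff g).
Proof.
by case/andP => /(opp_root root_system) gPhi gk; rewrite /level /= gPhi normrN.
Qed.

Lemma level_nat a (r : nat) : a \in Phi -> (r <= k)%N -> level Phi k (a, r%:Z).
Proof. by move=> aPhi rk; rewrite /level /= aPhi. Qed.

Lemma hyp_aff a (r : nat) x : hyp a r%:R x <-> aff (a, r%:Z) x = 0.
Proof.
rewrite /hyp /aff /= -pmulrn; split=> [->|/eqP]; first by rewrite subrr.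
by rewrite subr_eq0 => /eqP.
Qed.

Lemma cat_complementE x : cat_complement Phi k x <-> regular x.
Proof.
split=> [xc [a m] gl|x_reg H [a [r [aPhi rk ->]]] /hyp_aff]; last first.
  exact/eqP/x_reg/level_nat.
have [r [Er rk]] : exists r : nat, (m = r%:Z \/ m = - r%:Z) /\ (r <= k)%N.
  by exists `|m|%N; case/andP: gl => /= _; lia.
have aPhi : a \in Phi by case/andP: gl.
apply/eqP => ax; case: Er ax => -> ax.
  by apply: (xc (hyp a r%:R)); [exists a, r|apply/hyp_aff].
apply: (xc (hyp (- a) r%:R)).
  by exists (- a), r; split=> //; exact: opp_root.
apply/hyp_aff; rewrite -[r%:Z]opprK -[LHS]/(aff (opp_aff (a, - r%:Z)) x).
by rewrite aff_opp ax oppr0.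
Qed.

Lemma cell_refl x : regular x -> cell x x.
Proof. by move=> xr g /xr; rewrite -expr2 exprn_even_gt0. Qed.

Lemma cell_regular x y : cell x y -> regular y.
Proof.
by move=> xy g /xy; apply: contraTneq => ->; rewrite mulr0 ltxx.
Qed.

Lemma cell_eq x y : cell x y -> cell x = cell y.
Proof.
move=> xy; apply/seteqP; split=> z zc g gl.
  by apply: mulr_sign_gt0 (xy g gl) (zc g gl).
by apply: mulr_sign_gt0 (zc g gl); rewrite mulrC; exact: xy.
Qed.

(** The image of a connected set under an affine function is an interval, here avoiding 0.
    Conversely, the segment from [x] to a point of the cell stays in the cell. *)
Lemma component_cell x : regular x ->
  connected_component (cat_complement Phi k) x = cell x.
Proof.
move=> xr; apply/seteqP; split=> [y [C [Cx CA Cc] Cy] g gl|y xy].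
  have Ic : connected ((aff g) @` C).
    apply: connected_continuous_connected => //.
    by apply: continuous_subspaceT; exact: continuous_aff.
  move/connected_intervalP: Ic => Ii; rewrite ltNge; apply/negP => g0.
  have : (aff g @` C) 0.
    have [gx|gx] := leP 0 (aff g x).
      apply: (Ii (aff g y) (aff g x)); [by exists y|by exists x|].
      rewrite gx andbT leNgt; apply/negP => gy; move: g0; apply/negP.
      rewrite -ltNge mulr_gt0 // lt_def gx andbT.
      exact: xr.
    apply: (Ii (aff g x) (aff g y)); [by exists x|by exists y|].
    rewrite (ltW gx) /= leNgt; apply/negP => gy; move: g0; apply/negP.
    by rewrite -ltNge nmulr_rgt0.
  by case=> z /CA/cat_complementE/(_ g gl)/eqP.
pose B := (fun t : R => x + t *: (y - x)) @` `[0, 1].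
apply: (@connected_component_max _ _ B).
- by exists 0; rewrite ?scale0r ?addr0 //= in_itv /= lexx ler01.
- move=> z [t + <-]; rewrite /= in_itv /= => /andP[t0 t1].
  apply/cat_complementE/(@cell_regular x) => g gl.
  rewrite aff_line mulrDr mulrCA [X in _ + X]mulrCA.
  have [->|t_neq1] := eqVneq t 1; first by rewrite subrr mul0r add0r mul1r xy.
  apply: ltr_pwDl; last exact: mulr_ge0 t0 (ltW (xy g gl)).
  apply: mulr_gt0; first by rewrite subr_gt0 lt_neqAle t_neq1.
  exact: cell_refl.
- apply: connected_continuous_connected; first exact: segment_connected.
  by apply: continuous_subspaceT; exact: continuous_line.
- by exists 1; rewrite /= ?in_itv /= ?ler01 ?lexx // scale1r addrC subrK.
Qed.

(** A strict violation persists nearby; conversely, a small move from [y] towards [x] makes all weak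
    inequalities strict. *)
Lemma closure_cell x : regular x -> closure (cell x) = closed_cell x.
Proof.
move=> xr; apply/seteqP; split=> y.
  move=> yc g gl; rewrite leNgt; apply/negP => gy.
  have : \forall z \near y, forall h, h \in [:: g] -> 0 < - aff g x * aff h z.
    apply: (near_aff_sign (c := fun=> - aff g x)) => h; rewrite inE => /eqP ->.
    by rewrite mulNr oppr_gt0.
  move=> /yc[z [/(_ g gl) xz /(_ g (mem_head _ _))]].
  by rewrite mulNr oppr_gt0 ltNge ltW.
move=> yw B /(near_line x)[e e0 eB].
pose t := Num.min e 1.
have t0 : 0 < t by rewrite lt_min e0 ltr01.
exists (y + t *: (x - y)); split; last by apply: eB; rewrite gtr0_norm // ge_min lexx.
move=> g gl; rewrite aff_line mulrDr mulrCA [X in _ + X]mulrCA.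
apply: ltr_wpDl; last by apply: mulr_gt0 => //; exact: cell_refl.
by apply: mulr_ge0; [rewrite subr_ge0 ge_min lexx orbT|exact: yw].
Qed.

(* A point in the relative interior of a facet of the region of [x]. *)
Definition generic x f : Prop := exists y, aff f y = 0 /\
  forall g, level Phi k g -> g != f -> g != opp_aff f -> 0 < aff g x * aff g y.

(** At a relatively interior point of the facet, any function other than that of the wall and its
    negative would change sign along the hyperplane if it vanished. Conversely, nonzero signs
    persist nearby. *)
Lemma wall_generic x a (r : nat) : regular x -> a \in Phi -> (r <= k)%N ->
  is_wall Phi k (cell x) (hyp a r%:R) <-> generic x (a, r%:Z).
Proof.
move=> xr aPhi rk; rewrite /is_wall closure_cell //; split.
  move=> [_ [y [/hyp_aff fy near_y]]]; exists y; split=> // g gl g_neq_f g_neq_fN.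
  have yH : hyp a r%:R y by apply/hyp_aff.
  have yw : closed_cell x y by exact: nbhs_singleton near_y yH.
  rewrite lt_def (yw g gl) andbT mulf_neq0 ?xr //; apply/eqP => gy.
  have aa0 : dotp a a != 0 by rewrite dotpp_eq0 (root_neq0 root_system).
  (* [v] is the part of the gradient of [g] parallel to the hyperplane. Small moves along [v] in
     both senses stay in the facet, which forces [v = 0]. *)
  pose c := dotp g.1 a / dotp a a; pose v := g.1 - c *: a.
  have va : dotp v a = 0 by rewrite dotpBl dotpZl divfK // subrr.
  have [e e0 eH] := near_line (y + v) near_y.
  have line_g t : aff g (y + t *: v) = t * dotp v g.1.
    by move: gy; rewrite /aff dotpDl dotpZl; lra.
  have tw t : `|t| <= e -> 0 <= aff g x * (t * dotp v g.1).
    move=> te; rewrite -line_g; have := eH t te; rewrite addrAC subrr add0r.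
    by apply=> //; rewrite /hyp /= dotpDl dotpZl va mulr0 addr0.
  have vg : dotp v g.1 = 0.
    have := tw e; have := tw (- e); rewrite normrN gtr0_norm // lexx.
    rewrite mulNr mulrN oppr_ge0 => /(_ isT) h1 /(_ isT) h2.
    have /eqP := le_anti (introT andP (conj h1 h2)).
    by rewrite !mulf_eq0 (negPf (xr g gl)) (gt_eqF e0) => /eqP.
  have v0 : v == 0 by rewrite -dotpp_eq0 /v dotpBr dotpZr va mulr0 subr0 -/v vg.
  move: v0; rewrite /v subr_eq0 => /eqP gE.
  have gPhi : g.1 \in Phi by case/andP: gl.
  have [_ _ Pprop _ _] := root_system.
  have yaE : dotp y a = r%:R by [].
  have g2E : g.2%:~R = c * r%:R :> R.
    by apply/esym/eqP; move: gy => /eqP; rewrite /aff gE dotpZr yaE subr_eq0.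
  have [c1|cN1] : c = 1 \/ c = -1 by apply: (Pprop a) => //; rewrite -gE.
    case/eqP: g_neq_f; rewrite [g]surjective_pairing gE c1 scale1r; congr pair.
    by apply: (@intr_inj R); rewrite g2E c1 mul1r.
  case/eqP: g_neq_fN; rewrite [g]surjective_pairing gE cN1 scaleN1r; congr pair.
  by apply: (@intr_inj R); rewrite g2E cN1 mulN1r rmorphN.
move=> [y [fy y_gen]]; split; first by exists a, r.
exists y; split; first exact/hyp_aff.
pose L := [seq g <- @levels _ _ Phi k | (g != (a, r%:Z)) && (g != opp_aff (a, r%:Z))].
have : \forall z \near y, forall g, g \in L -> 0 < aff g x * aff g z.
  apply: (near_aff_sign (c := fun g => aff g x)) => g.
  rewrite mem_filter => /andP[/andP[g1 g2]].
  by rewrite mem_levels => gl; exact: y_gen.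
apply: (@filterS _ _ (nbhs_filter y)) => z zL /hyp_aff fz g gl.
have [->|g_neq_f] := eqVneq g (a, r%:Z); first by rewrite fz mulr0.
have [->|g_neq_fN] := eqVneq g (opp_aff (a, r%:Z)).
  by rewrite !aff_opp fz oppr0 mulr0.
by rewrite ltW // zL // mem_filter g_neq_f g_neq_fN mem_levels.
Qed.

End Cells.

(** * Opposite regions *)

(** The opposite region is reached through chosen points, so it is given first as a relation, from
    which choice extracts a function. *)
Lemma bij_of_rel (T : Type) (A B : set T) (r : T -> T -> Prop) :
  (forall a, A a -> exists b, B b /\ r a b) ->
  (forall b, B b -> exists a, A a /\ r a b) ->
  (forall a b b', r a b -> r a b' -> b = b') ->
  (forall a a' b, r a b -> r a' b -> a = a') ->
  exists f : T -> T, set_bij A B f.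
Proof.
move=> rAB rBA r_fun r_inj.
have total a : exists b, A a -> B b /\ r a b.
  have [/rAB[b Bb]|nA] := pselect (A a); first by exists b.
  by exists a.
have [f fP] := choice total.
exists f; split.
- by move=> a /fP[].
- by move=> a a'; rewrite !inE => /fP[_ ra] /fP[_ ra'] E; apply: r_inj ra _; rewrite E.
- move=> b Bb; have [a [Aa ra]] := rBA b Bb; exists a => //.
  by apply: r_fun ra; case: (fP a Aa).
Qed.

Section OppositeRegions.
Context {R : realType} {n : nat} {Phi : seq 'rV[R]_n} {k : nat}.
Hypothesis root_system : is_cryst_root_system Phi.
Notation affine := ('rV[R]_n * int)%type.
Notation regular := (regular Phi k).
Notation closed_cell := (@closed_cell _ _ Phi k).
Notation cell := (@cell _ _ Phi k).
Notation generic := (@generic _ _ Phi k).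
Context {M : seq affine}.
Hypothesis M_level : forall f, f \in M -> level Phi k f.
Implicit Types (g f : affine) (p q x y : 'rV[R]_n).

Definition in_flat p : Prop := forall f, f \in M -> aff f p = 0.

(* [p] lies in the relative interior of the intersection of the closed region
   of [x] with all the hyperplanes of [M]. *)
Definition face_center x p : Prop := [/\ in_flat p, closed_cell x p &
  forall q, in_flat q -> closed_cell x q ->
    forall g, level Phi k g -> aff g p = 0 -> aff g q = 0].

(** The signs of a small reflected copy of [x] in [p]: exactly the hyperplanes through [p] are
    crossed. *)
Definition opposite p x x' : Prop := forall g, level Phi k g ->
  (aff g p != 0 -> 0 < aff g x * aff g x') /\
  (aff g p = 0 -> aff g x * aff g x' < 0).

Definition opposite_points x x' : Prop := exists2 p, face_center x p & opposite p x x'.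

(** The point is the reflection of [q] in [p], scaled down until it lies on the same side as [p] of
    every hyperplane missing [p]. *)
Lemma near_sign p q : exists2 e : R, 0 < e & forall g, level Phi k g ->
  aff g p != 0 -> 0 < aff g p * aff g (p - e *: (q - p)).
Proof.
pose L := [seq g <- @levels _ _ Phi k | aff g p != 0].
have : \forall y \near p, forall g, g \in L -> 0 < aff g p * aff g y.
  apply: (near_aff_sign (c := fun g => aff g p)) => g; rewrite mem_filter.
  by case/andP => gp _; rewrite -expr2 exprn_even_gt0.
move=> /(near_line q)[e e0 eL]; exists e => // g gl gp.
rewrite -scaleNr; apply: eL; first by rewrite normrN gtr0_norm.
by rewrite mem_filter gp mem_levels.
Qed.

Lemma aff_reflect g p q e : aff g p = 0 ->
  aff g (p - e *: (q - p)) = - (e * aff g q).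
Proof. by move=> gp; rewrite -scaleNr aff_line gp mulr0 add0r mulNr. Qed.

Lemma closed_cell_neq0 x p g : regular x -> closed_cell x p -> level Phi k g ->
  aff g p != 0 -> 0 < aff g x * aff g p.
Proof. by move=> xr xp gl gp; rewrite lt_def xp // andbT mulf_neq0 // xr. Qed.

Lemma opposite_sym p x x' : opposite p x x' -> opposite p x' x.
Proof. by move=> op g gl; rewrite mulrC; exact: op. Qed.

Lemma opposite_regular p x x' : opposite p x x' -> regular x'.
Proof.
move=> op g gl; have [op1 op2] := op g gl; have [gp|gp] := eqVneq (aff g p) 0.
  by apply: contraTneq (op2 gp) => ->; rewrite mulr0 ltxx.
by apply: contraTneq (op1 gp) => ->; rewrite mulr0 ltxx.
Qed.

(** A scaled reflection in [p] carries a point of the face of [x'] to the face of [x], where the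
    interior property of [p] applies. *)
Lemma face_center_sym p x x' : regular x -> face_center x p -> opposite p x x' ->
  face_center x' p.
Proof.
move=> xr [Xp xp p_int] op; split=> //.
  move=> g gl; have [->|gp] := eqVneq (aff g p) 0; first by rewrite mulr0.
  by apply: mulr_sign_ge0 (xp g gl); case: (op g gl) => /(_ gp).
move=> q Xq xq g gl gp; have [e e0 eP] := near_sign p q.
pose q' := p - e *: (q - p).
have Xq' : in_flat q'.
  by move=> f fM; rewrite /q' aff_reflect ?Xp // Xq // mulr0 oppr0.
have xq' : closed_cell x q'.
  move=> h hl; have [hp|hp] := eqVneq (aff h p) 0.
    rewrite /q' aff_reflect // mulrN mulrCA -mulrN mulr_ge0 ?(ltW e0) //.
    have [_ /(_ hp) hxx'] := op h hl.
    rewrite -mulNr; apply: mulr_sign_ge0 (xq h hl).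
    by rewrite mulrC mulNr oppr_gt0.
  apply/ltW; apply: mulr_sign_gt0 (eP h hl hp).
  by rewrite mulrC; exact: closed_cell_neq0.
have := p_int _ Xq' xq' g gl gp; rewrite /q' aff_reflect // => /eqP.
by rewrite oppr_eq0 mulf_eq0 (gt_eqF e0) => /eqP.
Qed.

Lemma opposite_points_sym x x' : regular x ->
  opposite_points x x' -> opposite_points x' x.
Proof.
move=> xr [p xp op]; exists p; last exact: opposite_sym.
exact: face_center_sym xp op.
Qed.

(** Each of the centers [p] and [q] lies in the face of the other, so both lie on the same
    hyperplanes. Hence the opposite region depends on neither representative nor center. *)
Lemma opposite_points_cell x y x' y' : cell x y ->
  opposite_points x x' -> opposite_points y y' -> cell x' y'.
Proof.
move=> xy [p [Xp xp p_int] op] [q [Xq yq q_int] oq] g gl.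
have xyg := xy g gl.
have xq : closed_cell x q.
  by move=> h hl; apply: mulr_sign_ge0 (yq h hl); rewrite mulrC xy.
have yp : closed_cell y p by move=> h hl; exact: mulr_sign_ge0 (xy h hl) (xp h hl).
have [op1 op2] := op g gl; have [oq1 oq2] := oq g gl.
have [gp|gp] := eqVneq (aff g p) 0.
  have gq := p_int q Xq xq g gl gp.
  have x'g : 0 < aff g x * - aff g x' by rewrite mulrN oppr_gt0 op2.
  have y'g : 0 < aff g y * - aff g y' by rewrite mulrN oppr_gt0 oq2.
  rewrite -mulrNN; apply: mulr_sign_gt0 x'g _.
  by apply: mulr_sign_gt0 y'g; rewrite mulrC.
have gq : aff g q != 0.
  by apply: contra_neq gp => gq; exact: q_int p Xp yp g gl gq.
apply: mulr_sign_gt0 (op1 gp) _.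
by apply: mulr_sign_gt0 (oq1 gq); rewrite mulrC.
Qed.

(** Functions are treated one at a time: if one is nonzero at some point of the face, [p] moves to
    the midpoint with it. The midpoint lies only on hyperplanes containing both ends. *)
Lemma face_center_exists x : regular x ->
  (exists q, in_flat q /\ closed_cell x q) -> exists p, face_center x p.
Proof.
move=> xr [q0 [Xq0 xq0]].
suff aux : forall L : seq affine, exists p, [/\ in_flat p, closed_cell x p &
    forall g, g \in L -> level Phi k g -> forall q, in_flat q -> closed_cell x q ->
      aff g p = 0 -> aff g q = 0].
  have [p [Xp xp pL]] := aux (@levels _ _ Phi k); exists p; split=> //.
  by move=> q Xq xq g gl; apply: (pL g) => //; rewrite mem_levels.
elim=> [|g L [p [Xp xp pL]]]; first by exists q0; split.
have [gq|nq] := pselect (exists q, [/\ in_flat q, closed_cell x q,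
    level Phi k g & aff g q <> 0]); last first.
  exists p; split=> // h; rewrite inE => /predU1P[->|hL] hl q Xq xq hp.
    by apply: contrapT => gq; apply: nq; exists q.
  exact: (pL h).
have [q [Xq xq gl gq0]] := gq.
have midE h : aff h (p + 2^-1 *: (q - p)) = 2^-1 * (aff h p + aff h q).
  by rewrite aff_line; lra.
have mid0 h : level Phi k h -> aff h (p + 2^-1 *: (q - p)) = 0 ->
    aff h p = 0 /\ aff h q = 0.
  rewrite midE => hl /eqP; rewrite mulf_eq0 invr_eq0 pnatr_eq0 /= => /eqP pq.
  have := xp h hl; have := xq h hl; have := xr h hl.
  have -> : aff h q = - aff h p by apply/eqP; rewrite -addr_eq0 addrC pq.
  rewrite mulrN oppr_ge0 => hx h1 h2.
  have /eqP := le_anti (introT andP (conj h1 h2)).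
  by rewrite mulf_eq0 (negPf hx) => /eqP ->; rewrite oppr0.
exists (p + 2^-1 *: (q - p)); split.
- by move=> f fM; rewrite midE Xp // Xq // addr0 mulr0.
- move=> h hl; rewrite midE mulrCA mulr_ge0 ?invr_ge0 ?ler0n //.
  by rewrite mulrDr addr_ge0 ?xp ?xq.
- move=> h; rewrite inE => /predU1P[->|hL] hl q' Xq' xq' /(mid0 _ hl)[hp hq] //.
  exact: (pL h).
Qed.

(** A generic point of the facet, reflected in [p] at small scale, is generic for the opposite
    region. *)
Lemma generic_opposite x x' p f : regular x -> in_flat p -> closed_cell x p ->
  f \in M -> opposite p x x' -> generic x f -> generic x' f.
Proof.
move=> xr Xp xp fM op [y [fy y_gen]]; have [e e0 eP] := near_sign p y.
exists (p - e *: (y - p)); split; first by rewrite aff_reflect ?Xp // fy mulr0 oppr0.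
move=> g gl gf gfN; have [op1 op2] := op g gl.
have [gp|gp] := eqVneq (aff g p) 0; last first.
  apply: mulr_sign_gt0 (op1 gp) _; apply: mulr_sign_gt0 (eP g gl gp).
  by rewrite mulrC; exact: closed_cell_neq0.
rewrite aff_reflect // mulrN mulrCA -mulrN mulr_gt0 // -mulNr.
apply: mulr_sign_gt0 (y_gen g gl gf gfN).
by rewrite mulrN oppr_gt0 op2.
Qed.

(** At a generic point of the facet [f] vanishes and all other functions positive at [x] are
    positive, which excludes a larger level and a decomposition. *)
Lemma generic_wall_like (s : int) x f : above Phi k x f ->
  0 < s * f.2 -> 0 < s%:~R * dotp x f.1 -> generic x f ->
  @wall_like _ _ Phi k x s f.
Proof.
move=> fa fl fs [y [fy y_gen]].
have a_neq0 a : a \in Phi -> a != 0 by exact: (root_neq0 root_system).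
have fPhi := above_root fa.
have above_neqN g : above Phi k x g -> g != opp_aff f.
  move=> /andP[_ gx]; apply: contraTneq gx => ->; rewrite aff_opp oppr_gt0 -leNgt.
  by case/andP: fa => _ /ltW.
have gy_gt0 g : above Phi k x g -> g != f -> 0 < aff g y.
  move=> ga gf; have := y_gen g (above_level ga) gf (above_neqN g ga).
  by case/andP: ga => _ gx; rewrite pmulr_rgt0.
split=> // [m fma|g h ga ha ghf].
  rewrite leNgt; apply/negP => fm.
  have : 0 < aff (f.1, m) y.
    by apply: gy_gt0 => //; apply: contraTneq fm => <-; rewrite ltxx.
  by move: fy fm; rewrite /aff /= -(ltr_int R); lra.
have fE : aff f y = aff g y + aff h y.
  by rewrite -ghf /aff /= dotpDr rmorphD /=; lra.
have gf : g != f.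
  apply: contraTneq (a_neq0 _ (above_root ha)) => gf; rewrite negbK.
  have := congr1 fst ghf; rewrite /= gf => /esym/eqP.
  by rewrite addrC -subr_eq subrr eq_sym.
have hf : h != f.
  apply: contraTneq (a_neq0 _ (above_root ga)) => hf; rewrite negbK.
  have := congr1 fst ghf; rewrite /= hf => /esym/eqP.
  by rewrite -subr_eq subrr eq_sym.
by move: (gy_gt0 g ga gf) (gy_gt0 h ha hf) fE; rewrite fy; lra.
Qed.

End OppositeRegions.

(** * Floors and ceilings as signs, and their exchange by opposition *)

Section FloorsCeilings.
Context {R : realType} {n : nat} {Phi : seq 'rV[R]_n} {k : nat}.
Hypothesis root_system : is_cryst_root_system Phi.
Notation affine := ('rV[R]_n * int)%type.
Notation regular := (regular Phi k).
Notation cell := (@cell _ _ Phi k).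
Notation generic := (@generic _ _ Phi k).
Implicit Types (g f : affine) (p q x y : 'rV[R]_n).

Lemma generic_opp x f : generic x f -> generic x (opp_aff f).
Proof.
move=> [y [fy y_gen]]; exists y; rewrite aff_opp fy oppr0; split=> // g gl gN gf.
by apply: y_gen => //; rewrite -(opp_affK f).
Qed.

Lemma aff_nat a (r : nat) x : aff (a, r%:Z) x = dotp x a - r%:R.
Proof. by rewrite /aff /= -pmulrn. Qed.

Lemma cell_aff_gt0 x y g : cell x y -> level Phi k g -> 0 < aff g x -> 0 < aff g y.
Proof. by move=> xy gl gx; rewrite -(pmulr_rgt0 _ gx) xy. Qed.

(** As [r] is positive, the function is negative at the origin, so only its sign at [x] matters. *)
Lemma floorP x a (r : nat) : regular x -> a \in Phi -> (0 < r <= k)%N ->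
  is_floor Phi k (cell x) a r%:R <->
  generic x (a, r%:Z) /\ 0 < aff (a, r%:Z) x.
Proof.
move=> xr aPhi /andP[r0 rk]; pose wallE := wall_generic root_system xr aPhi rk; split.
  move=> [/wallE x_gen _ /(_ x (cell_refl xr))]; rewrite -aff_nat dotp0l sub0r mulrN.
  by rewrite oppr_lt0 pmulr_lgt0 ?ltr0n.
move=> [x_gen fx]; split; first exact/wallE.
  by rewrite /hyp /= dotp0l => /esym/eqP; rewrite pnatr_eq0 gtn_eqF.
move=> y xy; rewrite -aff_nat dotp0l sub0r mulrN oppr_lt0 pmulr_lgt0 ?ltr0n //.
exact: cell_aff_gt0 xy (level_nat aPhi rk) fx.
Qed.

Lemma ceilingP x a (r : nat) : regular x -> a \in Phi -> (0 < r <= k)%N ->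
  is_ceiling Phi k (cell x) a r%:R <->
  generic x (a, r%:Z) /\ aff (a, r%:Z) x < 0.
Proof.
move=> xr aPhi /andP[r0 rk]; pose wallE := wall_generic root_system xr aPhi rk; split.
  move=> [/wallE x_gen _ /(_ x (cell_refl xr))]; rewrite -aff_nat dotp0l sub0r mulrN.
  by rewrite oppr_gt0 pmulr_llt0 ?ltr0n.
move=> [x_gen fx]; split; first exact/wallE.
  by rewrite /hyp /= dotp0l => /esym/eqP; rewrite pnatr_eq0 gtn_eqF.
move=> y xy; rewrite -aff_nat dotp0l sub0r mulrN oppr_gt0 pmulr_llt0 ?ltr0n //.
rewrite -oppr_gt0 -aff_opp; apply: cell_aff_gt0 xy _ _.
  exact/level_opp/level_nat.
by rewrite aff_opp oppr_gt0.
Qed.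

Context {PhiP : set 'rV[R]_n} {M : seq affine}.
Hypothesis PhiP_sub : forall a, PhiP a -> a \in Phi.
Hypothesis M_pos : forall f, f \in M -> PhiP f.1 /\ 0 < f.2 <= k%:Z.

(** With [s = 1] the hyperplanes of [M] are floors, with [s = -1] ceilings; one argument then serves
    both directions. *)
Definition has_walls (s : int) x : Prop := [/\ regular x,
  forall a, PhiP a -> 0 < dotp x a &
  forall f, f \in M -> generic x f /\ 0 < s%:~R * aff f x].

Lemma M_level f : f \in M -> level Phi k f.
Proof.
move=> /M_pos[/PhiP_sub fPhi /andP[f0 fk]].
by rewrite /level fPhi gtr0_norm.
Qed.

(** Chooses the defining function that is positive on the region. *)
Definition orient (s : int) f : affine := if s == 1 then f else opp_aff f.

Lemma has_walls_wall_like s x f : s = 1 \/ s = -1 -> has_walls s x -> f \in M ->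
  @wall_like _ _ Phi k x s (orient s f).
Proof.
move=> s_sign [xr x_dom xW] fM; have [fP /andP[f0 _]] := M_pos fM.
have [x_gen] := xW f fM; have := x_dom _ fP; have fl := M_level fM.
case: s_sign => ->; rewrite /orient /=.
  rewrite !mul1r => xf fx; apply: (generic_wall_like root_system) => //.
  - by rewrite /above fl.
  - by rewrite mul1r.
  - by rewrite mul1r.
rewrite mulrN1z mulN1r => xf fx; apply: (generic_wall_like root_system).
- by rewrite /above level_opp // aff_opp.
- by rewrite mulN1r /= opprK.
- by rewrite mulrN1z mulN1r /= dotpNr opprK.
- exact: generic_opp.
Qed.

Lemma aff_orient_eq0 s f p : aff (orient s f) p = 0 -> aff f p = 0.
Proof.
rewrite /orient; case: ifP => // _; rewrite aff_opp => /eqP.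
by rewrite oppr_eq0 => /eqP.
Qed.

Lemma flat_point s x a : s = 1 \/ s = -1 -> has_walls s x -> PhiP a ->
  exists q, [/\ @in_flat _ _ M q, @closed_cell _ _ Phi k x q & 0 < dotp q a].
Proof.
move=> s_sign xW aP; have [xr x_dom _] := xW.
have [|p [pM p_ge0 pa]] := face_point root_system xr s_sign
    (M := map (orient s) M) _ (PhiP_sub aP) (x_dom a aP).
  by move=> _ /mapP[f fM ->]; exact: has_walls_wall_like.
exists p; split=> // [f fM|g gl].
  by apply: (@aff_orient_eq0 s); rewrite pM ?map_f.
have [gx|gx] := leP (aff g x) 0.
  have gx0 : 0 < - aff g x by rewrite oppr_gt0 lt_neqAle xr.
  rewrite -mulrNN mulr_ge0 ?(ltW gx0) // -aff_opp p_ge0 // /above level_opp //.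
  by rewrite aff_opp.
by rewrite mulr_ge0 ?(ltW gx) // p_ge0 // /above gl.
Qed.

Lemma opposite_exists s x : s = 1 \/ s = -1 -> has_walls s x ->
  exists x', has_walls (- s) x' /\ @opposite_points _ _ Phi k M x x'.
Proof.
move=> s_sign xW; have [xr x_dom x_gen] := xW.
have [|p xp] := @face_center_exists _ _ Phi k M x xr.
  (* A point of the face comes from a positive root supplied by [M]; for empty [M] the face is the
     whole closed region and [x] serves. *)
  have [M0|[f /M_pos[fP _]]] : M = [::] \/ exists f, f \in M.
  - by case: (M) => [|f M']; [left|right; exists f; rewrite mem_head].
  - exists x; split=> [f|g gl]; first by rewrite M0.
    by rewrite -expr2 sqr_ge0.
  - by have [q [Xq xq _]] := flat_point s_sign xW fP; exists q.
have [Xp cp p_int] := xp.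
have [e e0 eP] := @near_sign _ _ Phi k p x.
pose x' := p - e *: (x - p).
have op : @opposite _ _ Phi k p x x'.
  move=> g gl; split=> gp.
    apply: (mulr_sign_gt0 _ (eP g gl gp)); rewrite mulrC.
    exact: closed_cell_neq0 xr cp gl gp.
  rewrite /x' aff_reflect // mulrN oppr_lt0 mulrCA mulr_gt0 //.
  by rewrite -expr2 exprn_even_gt0 // xr.
exists x'; split; last by exists p.
split=> [|a aP|f fM].
- exact: opposite_regular op.
- have al : level Phi k (a, 0) by rewrite /level /= PhiP_sub // normr0.
  have aff0 y : aff (a, 0) y = dotp y a by rewrite /aff subr0.
  have [q [Xq xq]] := flat_point s_sign xW aP; rewrite -aff0 => qa.
  have [op1 _] := op _ al.
  (* The face contains [q] with [<q, a>] positive, so its center avoids the hyperplane of [a]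
     through the origin, and dominance survives. *)
  have /op1 : aff (a, 0) p != 0.
    apply/eqP => pa; have := p_int q Xq xq _ al pa => qa0.
    by rewrite qa0 ltxx in qa.
  by rewrite !aff0 pmulr_rgt0 // x_dom.
- have [f_gen fx] := x_gen f fM; split.
    exact: (generic_opposite (M := M) xr Xp cp fM op).
  have [_ /(_ (Xp f fM)) ff'] := op f (M_level fM).
  have : 0 < aff f x * (- aff f x') by rewrite mulrN oppr_gt0.
  rewrite rmorphN mulNr -mulrN => ff'_gt0; apply: mulr_sign_gt0 ff'_gt0.
  by rewrite mulrC.
Qed.

End FloorsCeilings.

Theorem theorem1 (R : realType) (n : nat) (Phi : seq 'rV[R]_n)
  (PhiP : set 'rV[R]_n) (k : nat) (M : seq ('rV[R]_n * nat)) :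
  is_cryst_root_system Phi ->
  is_positive_system Phi PhiP ->
  (0 < k)%N ->
  (forall p, p \in M -> PhiP p.1 /\ (1 <= p.2 <= k)%N) ->
  exists f : set 'rV[R]_n -> set 'rV[R]_n,
    set_bij
      [set Rg | [/\ is_region Phi k Rg, dominant PhiP Rg &
                   forall p, p \in M -> is_floor Phi k Rg p.1 p.2%:R]]
      [set Rg | [/\ is_region Phi k Rg, dominant PhiP Rg &
                   forall p, p \in M -> is_ceiling Phi k Rg p.1 p.2%:R]]
      f.
Proof.
move=> root_system [x0 [_ PhiPE]] _ MP.
pose MA : seq ('rV[R]_n * int) := [seq (p.1, p.2%:Z) | p <- M].
have PhiP_sub a : PhiP a -> a \in Phi by move=> /PhiPE[].
have MA_pos f : f \in MA -> PhiP f.1 /\ 0 < f.2 <= k%:Z.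
  by case/mapP => p /MP[pP pk] ->.
pose walls s x := has_walls (Phi := Phi) (k := k) (PhiP := PhiP) (M := MA) s x.
pose cl := @cell _ _ Phi k.
have dominantE x : regular Phi k x ->
    dominant PhiP (cl x) <-> forall a, PhiP a -> 0 < dotp x a.
  move=> xr; split=> [x_dom a aP|x_dom a y aP xy].
    exact: x_dom a x aP (cell_refl xr).
  have affE z : dotp z a = aff (a, 0) z by rewrite /aff subr0.
  rewrite affE; apply: cell_aff_gt0 xy _ _; last by rewrite -affE x_dom.
  by rewrite /level /= PhiP_sub // normr0.
have regionE Rg : is_region Phi k Rg <-> exists2 x, regular Phi k x & Rg = cl x.
  have complE := cat_complementE (k := k) root_system.
  split=> [[x /complE xr ->]|[x xr ->]]; exists x => //.
  - exact: component_cell.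
  - exact/complE.
  - by rewrite component_cell.
have floorsE Rg : [/\ is_region Phi k Rg, dominant PhiP Rg &
      forall p, p \in M -> is_floor Phi k Rg p.1 p.2%:R] <->
    exists2 x, walls 1 x & Rg = cl x.
  split=> [[/regionE[x xr ->] /(dominantE x xr) x_dom x_fl]|[x [xr x_dom x_fl] ->]].
    exists x => //; split=> // f /mapP[p pM ->]; rewrite mul1r.
    have [pP pk] := MP p pM.
    exact/(floorP root_system xr (PhiP_sub _ pP) pk)/x_fl.
  split; [by apply/regionE; exists x|exact/dominantE|move=> p pM].
  have [pP pk] := MP p pM; apply/(floorP root_system xr (PhiP_sub _ pP) pk).
  have [? ] : _ := x_fl (p.1, p.2%:Z) (map_f (fun p => (p.1, p.2%:Z)) pM).
  by rewrite mul1r.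
have ceilingsE Rg : [/\ is_region Phi k Rg, dominant PhiP Rg &
      forall p, p \in M -> is_ceiling Phi k Rg p.1 p.2%:R] <->
    exists2 x, walls (-1) x & Rg = cl x.
  split=> [[/regionE[x xr ->] /(dominantE x xr) x_dom x_fl]|[x [xr x_dom x_fl] ->]].
    exists x => //; split=> // f /mapP[p pM ->]; rewrite mulrN1z mulN1r oppr_gt0.
    have [pP pk] := MP p pM.
    exact/(ceilingP root_system xr (PhiP_sub _ pP) pk)/x_fl.
  split; [by apply/regionE; exists x|exact/dominantE|move=> p pM].
  have [pP pk] := MP p pM; apply/(ceilingP root_system xr (PhiP_sub _ pP) pk).
  have [? ] : _ := x_fl (p.1, p.2%:Z) (map_f (fun p => (p.1, p.2%:Z)) pM).
  by rewrite mulrN1z mulN1r oppr_gt0.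
(* Regions are related through arbitrary representatives. As [r] is symmetric, its being functional
   also yields injectivity. *)
pose r (A B : set 'rV[R]_n) := exists x y, [/\ regular Phi k x, A = cl x, B = cl y,
  opposite_points (Phi := Phi) (k := k) (M := MA) x y & regular Phi k y].
have r_fun A B B' : r A B -> r A B' -> B = B'.
  move=> [x [y [xr -> -> xy _]]] [x' [y' [xr' xx' -> xy' _]]].
  apply: cell_eq; apply: opposite_points_cell xy xy'.
  by rewrite -/(cl x) xx'; exact: cell_refl.
have r_sym A B : r A B -> r B A.
  move=> [x [y [xr Ax By xy yr]]]; exists y, x; split=> //.
  exact: opposite_points_sym.
have r_ex s x : s = 1 \/ s = -1 -> walls s x ->
    exists y, walls (- s) y /\ r (cl x) (cl y).
  move=> s_sign xW; have [xr _ _] := xW.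
  have [y [yW xy]] := opposite_exists root_system PhiP_sub MA_pos s_sign xW.
  by exists y; split=> //; exists x, y; split=> //; case: yW.
apply: (bij_of_rel (r := r)).
- move=> A /floorsE[x xW ->]; have [|y [yW xy]] := r_ex 1 x _ xW; first by left.
  by exists (cl y); split=> //; apply/ceilingsE; exists y.
- move=> B /ceilingsE[y yW ->]; have [|x [xW yx]] := r_ex (-1) y _ yW; first by right.
  exists (cl x); split; last exact: r_sym.
  by apply/floorsE; exists x; rewrite // -[1]opprK.
- exact: r_fun.
- by move=> A A' B /r_sym rA /r_sym rA'; exact: r_fun rA rA'.
Qed.
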